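(* Let $S\subset\mathbb{A}^3=\mathrm{Spec}(\mathbb{C}[x,y,z])$ be the surface $z^2+y^2+x^3-1=0$, equipped with the $\mu_2$-action $\tau\cdot(x,y,z)=(x,y,-z)$, where $\tau$ is the nontrivial element of $\mu_2$. Then $S$ is weakly $\mu_2$-uniformly rational but not $\mu_2$-uniformly rational.
   Context: For an algebraic group $G$ and a $G$-variety $X$: $X$ is $G$-rational at $x$ if there exist a $G$-stable open neighborhood $U_x$ of $x$, an algebraic $G$-action on $\mathbb{A}^n$ and a $G$-stable open subset $U'\subset\mathbb{A}^n$ with $U_x$ $G$-equivariantly isomorphic to $U'$; $X$ is $G$-uniformly rational if it is $G$-rational at every point. $X$ is weakly $G$-rational at $x$ if there exist a $G$-stable open neighborhood $U_x$ of $x$, an open subvariety $V\subset\mathbb{A}^n$ equipped with a $G$-action (not necessarily extending to $\mathbb{A}^n$) and a $G$-equivariant isomorphism $U_x\simeq V$; $X$ is weakly $G$-uniformly rational if it is weakly $G$-rational at every point. *)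

(* Defs.v *)
From HB Require Import structures.
From mathcomp Require Import all_boot all_algebra.
From mathcomp Require Import Rstruct complex.

Set Implicit Arguments.
Unset Strict Implicit.
Unset Printing Implicit Defensive.
Import GRing.Theory Num.Theory.
Local Open Scope ring_scope.

Notation C := (complex Rdefinitions.R).

Definition Point (n : nat) : Type := 'I_n -> C.

(* Regular (polynomial) functions on A^n: the C-algebra generated by the
   coordinate functions (over the infinite field C, polynomial functions
   and polynomials coincide). *)
Inductive polyfun (n : nat) : (Point n -> C) -> Prop :=
| pf_const (c : C) : polyfun (fun _ => c)
| pf_var (i : 'I_n) : polyfun (fun p => p i)
| pf_add f g : polyfun f -> polyfun g -> polyfun (fun p => f p + g p)
| pf_mul f g : polyfun f -> polyfun g -> polyfun (fun p => f p * g p).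

Definition zopen (n : nat) (U : Point n -> Prop) : Prop :=
  exists F : (Point n -> C) -> Prop,
    (forall f, F f -> polyfun f) /\
    (forall p, U p <-> exists f, F f /\ f p != 0).

Definition open_in (n : nat) (X U : Point n -> Prop) : Prop :=
  exists W, zopen W /\ forall p, U p <-> (X p /\ W p).

(* Regular functions on a locally closed subset X of A^n
   (locally a quotient of polynomials, Hartshorne I.3). *)
Definition regular (n : nat) (X : Point n -> Prop) (f : Point n -> C) : Prop :=
  forall p, X p -> exists (W : Point n -> Prop) (g h : Point n -> C),
    [/\ zopen W, W p, polyfun g, polyfun h &
        forall q, X q -> W q -> h q != 0 /\ f q = g q / h q].

Definition morphism (n m : nat) (X : Point n -> Prop) (Y : Point m -> Prop)
    (phi : Point n -> Point m) : Prop :=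
  (forall p, X p -> Y (phi p)) /\ (forall i, regular X (fun p => phi p i)).

Definition isomorphism (n m : nat) (X : Point n -> Prop) (Y : Point m -> Prop)
    (phi : Point n -> Point m) : Prop :=
  morphism X Y phi /\
  exists psi : Point m -> Point n,
    [/\ morphism Y X psi,
        forall p, X p -> psi (phi p) = p &
        forall q, Y q -> phi (psi q) = q].

(* A mu_2-action is given by the action of the nontrivial element tau,
   an involution.  U is mu_2-stable for the involution t. *)
Definition stable (n : nat) (t : Point n -> Point n) (U : Point n -> Prop) :=
  forall p, U p -> U (t p).

Definition mu2_action_An (n : nat) (s : Point n -> Point n) : Prop :=
  (forall i, polyfun (fun p => s p i)) /\ (forall p, s (s p) = p).

Definition mu2_action_on (n : nat) (V : Point n -> Prop)
    (s : Point n -> Point n) : Prop :=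
  morphism V V s /\ (forall p, V p -> s (s p) = p).

Definition mu2_rational_at (m : nat) (X : Point m -> Prop)
    (t : Point m -> Point m) (x : Point m) : Prop :=
  exists (U : Point m -> Prop) (n : nat) (s : Point n -> Point n)
         (U' : Point n -> Prop) (phi : Point m -> Point n),
    open_in X U /\ U x /\ stable t U /\
    mu2_action_An s /\ zopen U' /\ stable s U' /\
    isomorphism U U' phi /\
    (forall p, U p -> phi (t p) = s (phi p)).

Definition mu2_uniformly_rational (m : nat) (X : Point m -> Prop)
    (t : Point m -> Point m) : Prop :=
  forall x, X x -> mu2_rational_at X t x.

(* Weak version: the mu_2-action on the open V of A^n need not extend. *)
Definition weakly_mu2_rational_at (m : nat) (X : Point m -> Prop)
    (t : Point m -> Point m) (x : Point m) : Prop :=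
  exists (U : Point m -> Prop) (n : nat) (V : Point n -> Prop)
         (s : Point n -> Point n) (phi : Point m -> Point n),
    open_in X U /\ U x /\ stable t U /\
    zopen V /\ mu2_action_on V s /\
    isomorphism U V phi /\
    (forall p, U p -> phi (t p) = s (phi p)).

Definition weakly_mu2_uniformly_rational (m : nat) (X : Point m -> Prop)
    (t : Point m -> Point m) : Prop :=
  forall x, X x -> weakly_mu2_rational_at X t x.

Definition cx : 'I_3 := @Ordinal 3 0 isT.
Definition cy : 'I_3 := @Ordinal 3 1 isT.
Definition cz : 'I_3 := @Ordinal 3 2 isT.

Definition S : Point 3 -> Prop :=
  fun p => (p cz) ^+ 2 + (p cy) ^+ 2 + (p cx) ^+ 3 - 1 = 0.

Definition tauS (p : Point 3) : Point 3 :=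
  fun i => if i == cz then - p i else p i.

(* Main.v *)
Require Import Defs.
From HB Require Import structures.
From mathcomp Require Import all_boot all_order all_algebra.
From mathcomp Require Import Rstruct complex ring zify.
From Stdlib Require Import FunctionalExtensionality Classical.
Set Implicit Arguments.
Unset Strict Implicit.
Unset Printing Implicit Defensive.
Import GRing.Theory Num.Theory.
Local Open Scope ring_scope.

(** With [u = y + i z] and [v = y - i z] the surface is [u v = 1 - x^3] and the involution swaps
    [u] and [v]. For a cube root of unity [w], the open set where the other two cube roots are
    avoided by [x] is stable and has the coordinates [u] and [(w - x) / u]; these three open
    sets cover the surface.

    Conversely a linearizable chart at [(0, 1, 0)] maps an open part of the elliptic curve
    [z = 0] into the fixed locus of a polynomial involution [s] of [A^n]. Comparing Jacobians
    gives [n <= 2]. For [n = 2] every curve fixed by [s] is rational: if [f] generates its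
    ideal then [f] divides [x - s x] and [y - s y]. The bracket [{s x, .}] is locally nilpotent,
    hence so is the bracket with any weighted leading form of [s x], and this forces that form
    to be a power of [x - g y^q] (up to a constant, when it has a zero on the torus). So an
    edge of the Newton polygon of [f] is removed by a shear [x -> x + g y^q], unless [f] already
    is [c x + r(y)], and the total degree of [f] can be lowered until the curve is a graph.
    Finally the affine cubic [y^2 = 1 - x^3] has no rational parametrization, by comparing
    degrees in the differential [dx / y]. *)

(** * Equivariant charts on the surface *)

(** Involutions of the plane are known to be linearizable, which would settle the fixed locus at
    once, but this rests on the structure of the automorphism group of [A^2]. Only a consequence for
    curves is proved: on an irreducible curve fixed by [s], both coordinates are polynomials in one
    function. Local nilpotency of [{s x, .}] comes from that of [{x, .}]: the Jacobian of [s] is a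
    nonzero constant, so [s] conjugates one bracket to the other up to a scalar. The number [n] is
    free in the definition of rationality, hence the bound on the dimension; for [n <= 1] the
    ambient coordinate itself is a parameter. The weak charts escape the obstruction because in
    their coordinates the involution has a denominator, whose zeros are removed. *)

Lemma zopen_nonzero n (k : Point n -> C) : polyfun k -> zopen (fun p => k p != 0).
Proof.
move=> hk; exists (fun f => f = k); split=> [f ->//|p]; split.
  by move=> kp; exists k.
by case=> f [->].
Qed.

Lemma zopen_full n : zopen (fun _ : Point n => True).
Proof.
exists (fun f => f = fun _ => 1); split=> [f ->|p]; first exact: pf_const.
by split=> // _; exists (fun _ => 1); rewrite oner_eq0.
Qed.

Lemma pf_opp n (f : Point n -> C) : polyfun f -> polyfun (fun p => - f p).
Proof.
move=> hf; rewrite (_ : (fun p => - f p) = fun p => (-1) * f p).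
  by apply: pf_mul => //; apply: pf_const.
by apply: functional_extensionality => p; rewrite mulN1r.
Qed.

Lemma pf_sub n (f g : Point n -> C) :
  polyfun f -> polyfun g -> polyfun (fun p => f p - g p).
Proof. by move=> hf /pf_opp; apply: pf_add. Qed.

Lemma pf_exp n (f : Point n -> C) m : polyfun f -> polyfun (fun p => f p ^+ m).
Proof.
move=> hf; elim: m => [|m IH]; first exact: pf_const.
rewrite (_ : (fun p => f p ^+ m.+1) = fun p => f p * f p ^+ m); first exact: pf_mul.
by apply: functional_extensionality => p; rewrite exprS.
Qed.

Ltac polyfun_tac :=
  repeat first [assumption | apply: pf_var | apply: pf_opp | apply: pf_exp
    | apply: pf_sub | apply: pf_add | apply: pf_mul | apply: pf_const].

Lemma regular_div n (X : Point n -> Prop) f g h : polyfun g -> polyfun h ->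
  (forall q, X q -> h q != 0 /\ f q = g q / h q) -> regular X f.
Proof.
move=> hg hh H p Xp; exists (fun _ => True), g, h; split=> //.
- exact: zopen_full.
- by move=> q Xq _; apply: H.
Qed.

Lemma regular_polyfun n (X : Point n -> Prop) f : polyfun f -> regular X f.
Proof.
move=> hf; apply: (regular_div hf (pf_const n 1)) => q _.
by rewrite oner_eq0 divr1.
Qed.

Definition pt2 (a b : C) : Point 2 := fun i => if i == ord0 then a else b.
Definition pt3 (a b c : C) : Point 3 :=
  fun i => if i == cx then a else if i == cy then b else c.

Lemma ord2P (i : 'I_2) : i = ord0 \/ i = ord_max.
Proof. by case: i => [[|[|//]] hi]; [left|right]; apply: val_inj. Qed.
Lemma ord3P (i : 'I_3) : [\/ i = cx, i = cy | i = cz].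
Proof.
by case: i => [[|[|[|//]]] hi];
  [constructor 1|constructor 2|constructor 3]; apply: val_inj.
Qed.

Lemma pt2_eta (p : Point 2) : pt2 (p ord0) (p ord_max) = p.
Proof. by apply: functional_extensionality => i; case: (ord2P i) => ->. Qed.
Lemma pt3_eta (p : Point 3) : pt3 (p cx) (p cy) (p cz) = p.
Proof. by apply: functional_extensionality => i; case: (ord3P i) => ->. Qed.

Lemma tauS_pt3 (p : Point 3) : tauS p = pt3 (p cx) (p cy) (- p cz).
Proof. by apply: functional_extensionality => i; case: (ord3P i) => ->. Qed.

Definition ic : C := 'i.
Lemma ic2 : ic ^+ 2 = -1. Proof. exact: sqrCi. Qed.

(* The cofactor of [w - x] in [w^3 - x^3]. *)
Definition cofac (w x : C) : C := w ^+ 2 + w * x + x ^+ 2.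

(** The second coordinate is [(w - x) / u] rewritten as [v / cofac w x], which stays defined where
    [u = 0]. On the surface the two coordinates multiply to [w - x], so [x] is recovered without
    division. *)
Definition chart (w : C) (p : Point 3) : Point 2 :=
  pt2 (p cy + ic * p cz) ((p cy - ic * p cz) / cofac w (p cx)).
Definition chart_x (w : C) (q : Point 2) : C := w - q ord0 * q ord_max.
Definition chart_v (w : C) (q : Point 2) : C :=
  q ord_max * cofac w (chart_x w q).
Definition chart_inv (w : C) (q : Point 2) : Point 3 :=
  pt3 (chart_x w q) ((q ord0 + chart_v w q) / 2) ((q ord0 - chart_v w q) / (2 * ic)).
Definition chart_dom (w : C) (p : Point 3) : Prop := S p /\ cofac w (p cx) != 0.
Definition chart_img (w : C) (q : Point 2) : Prop := cofac w (chart_x w q) != 0.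
(** The exchange of [u] and [v] in chart coordinates. Its denominator keeps it from being a
    polynomial map of the plane. *)
Definition chart_tau (w : C) (q : Point 2) : Point 2 :=
  pt2 (chart_v w q) (q ord0 / cofac w (chart_x w q)).
Lemma two0 : (2 : C) != 0. Proof. by rewrite pnatr_eq0. Qed.
Lemma ic0 : ic != 0. Proof. exact: neq0Ci. Qed.

Section Chart.
Variable w : C.
Hypothesis w3 : w ^+ 3 = 1.

Lemma S_norm p : S p ->
  (p cy + ic * p cz) * (p cy - ic * p cz) = (w - p cx) * cofac w (p cx).
Proof.
rewrite /S /cofac => Sp.
have -> : (p cy + ic * p cz) * (p cy - ic * p cz) = p cy ^+ 2 - ic ^+ 2 * p cz ^+ 2 by ring.
have -> : (w - p cx) * (w ^+ 2 + w * p cx + p cx ^+ 2) = w ^+ 3 - p cx ^+ 3 by ring.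
rewrite ic2 w3; apply/eqP; rewrite -subr_eq0 -Sp; apply/eqP; ring.
Qed.

Lemma chart_x_chart p : chart_dom w p -> chart_x w (chart w p) = p cx.
Proof.
case=> Sp q0; rewrite /chart_x /chart /pt2 /= mulrA S_norm // mulfK //; ring.
Qed.

Lemma chart_v_chart p : chart_dom w p -> chart_v w (chart w p) = p cy - ic * p cz.
Proof. by move=> Up; rewrite /chart_v chart_x_chart // divfK //; case: Up. Qed.

Lemma chartK p : chart_dom w p -> chart_inv w (chart w p) = p.
Proof.
move=> Up; rewrite /chart_inv chart_x_chart // chart_v_chart // -[RHS]pt3_eta.
have := ic0; have := two0; rewrite /chart /pt2 /= => h2 hi.
by congr pt3; field; rewrite ?hi ?h2.
Qed.

Lemma chart_inv_u q : chart_inv w q cy + ic * chart_inv w q cz = q ord0.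
Proof. by have := ic0; have := two0; rewrite /chart_inv /pt3 /= => h2 hi; field; rewrite ?hi ?h2. Qed.
Lemma chart_inv_v q : chart_inv w q cy - ic * chart_inv w q cz = chart_v w q.
Proof. by have := ic0; have := two0; rewrite /chart_inv /pt3 /= => h2 hi; field; rewrite ?hi ?h2. Qed.

Lemma chart_invK q : chart_img w q -> chart w (chart_inv w q) = q.
Proof.
move=> Vq; rewrite /chart chart_inv_u chart_inv_v {1}/chart_inv /= /chart_v mulfK //.
exact: pt2_eta.
Qed.

Lemma S_chart_inv q : S (chart_inv w q).
Proof.
have := chart_inv_u q; have := chart_inv_v q; have xE : chart_inv w q cx = chart_x w q by [].
rewrite /S xE; move: (chart_inv w q cy) (chart_inv w q cz) => y z vE uE.
have yz : y ^+ 2 + z ^+ 2 = q ord0 * chart_v w q.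
  by rewrite -vE -uE; transitivity (y ^+ 2 - ic ^+ 2 * z ^+ 2); [rewrite ic2|]; ring.
rewrite [z ^+ 2 + _]addrC yz -w3 /chart_v /cofac /chart_x; ring.
Qed.

Lemma chart_dom_inv q : chart_img w q -> chart_dom w (chart_inv w q).
Proof. by move=> Vq; split; [apply: S_chart_inv|]. Qed.

Lemma chart_img_chart p : chart_dom w p -> chart_img w (chart w p).
Proof. by move=> Up; rewrite /chart_img chart_x_chart //; case: Up. Qed.

Lemma chart_dom_tau p : chart_dom w p -> chart_dom w (tauS p).
Proof.
rewrite tauS_pt3 /chart_dom /S /pt3 /= => -[Sp ?]; split=> //.
by rewrite sqrrN.
Qed.

Lemma chart_tauE p : chart_dom w p -> chart w (tauS p) = chart_tau w (chart w p).
Proof.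
move=> Up; rewrite /chart_tau chart_v_chart // chart_x_chart // tauS_pt3 /chart /pt3 /=.
by congr pt2; rewrite mulrN ?opprK.
Qed.

Lemma chart_tau_conj q : chart_img w q ->
  chart_tau w q = chart w (tauS (chart_inv w q)).
Proof.
by move=> Vq; rewrite chart_tauE ?chart_invK //; apply: chart_dom_inv.
Qed.

Lemma tauSK p : tauS (tauS p) = p.
Proof.
by apply: functional_extensionality => i; rewrite /tauS; case: (i == cz); rewrite ?opprK.
Qed.

Lemma pf_cofac n (f : Point n -> C) : polyfun f -> polyfun (fun p => cofac w (f p)).
Proof. by move=> hf; rewrite /cofac; polyfun_tac. Qed.

Lemma pf_chart_x : polyfun (chart_x w).
Proof. by rewrite /chart_x; polyfun_tac. Qed.
Lemma pf_chart_v : polyfun (chart_v w).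
Proof. by apply: pf_mul (pf_var _) (pf_cofac pf_chart_x). Qed.

Lemma weakly_rational_chart p : chart_dom w p -> weakly_mu2_rational_at S tauS p.
Proof.
move=> Up; have hx := pf_chart_x; have hv := pf_chart_v.
exists (chart_dom w), 2, (chart_img w), (chart_tau w), (chart w).
split; first exists (fun p => cofac w (p cx) != 0).
  by split=> //; apply: zopen_nonzero; apply: pf_cofac; apply: pf_var.
split=> //; split; first exact: chart_dom_tau.
split; first by apply: zopen_nonzero; apply: pf_cofac.
split.
  split; last first.
    move=> q Vq; have Uq := chart_dom_inv Vq; rewrite (chart_tau_conj Vq).
    rewrite -chart_tauE ?tauSK ?chart_invK //; exact: chart_dom_tau.
  split=> [q Vq|i].
    rewrite chart_tau_conj //; apply: chart_img_chart; apply: chart_dom_tau.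
    exact: chart_dom_inv.
  case: (ord2P i) => ->; first exact: regular_polyfun.
  by apply: (regular_div (pf_var ord0) (pf_cofac hx)).
split; last exact: chart_tauE.
split; first split=> [|i]; first exact: chart_img_chart.
  case: (ord2P i) => ->; first by apply: regular_polyfun; rewrite /chart /pt2 /=; polyfun_tac.
  apply: (@regular_div _ _ _ (fun p => p cy - ic * p cz) (fun p => cofac w (p cx))).
  - by polyfun_tac.
  - by apply: pf_cofac; apply: pf_var.
  - by move=> q [].
exists (chart_inv w); split; last 2 first.
- exact: chartK.
- exact: chart_invK.
split; first exact: chart_dom_inv.
move=> i; apply: regular_polyfun.
by case: (ord3P i) => ->; rewrite /chart_inv /pt3 /=; polyfun_tac.
Qed.
End Chart.

Lemma weakly_rational_S : weakly_mu2_uniformly_rational S tauS.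
Proof.
move=> p Sp; have [w [w3 hw]] : exists w, w ^+ 3 = 1 /\ cofac w (p cx) != 0.
  (* If [x] is itself a cube root of unity, [w = x] works because the cofactor is then [3 x^2];
     otherwise any cube root works, and [w = 1] is taken. *)
  have [x3|x3] := eqVneq (p cx ^+ 3) 1.
    exists (p cx); split=> //.
    have -> : cofac (p cx) (p cx) = 3 * p cx ^+ 2 by rewrite /cofac; ring.
    rewrite mulf_neq0 ?pnatr_eq0 // expf_neq0 //.
    by apply/eqP => x0; move/eqP: x3; rewrite x0 expr0n /= eq_sym oner_eq0.
  exists 1; split; first exact: expr1n.
  apply/eqP => x0; case/eqP: x3; apply/eqP; rewrite -subr_eq0; apply/eqP.
  by transitivity ((p cx - 1) * cofac 1 (p cx)); [rewrite /cofac; ring | rewrite x0 mulr0].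
exact: (weakly_rational_chart w3).
Qed.

(** * Bivariate polynomials and the Poisson bracket *)

(* The inner variable is [x], the outer one is [y]; so the coefficient of [x^i y^j] in [b] is
   [b`_j`_i]. *)
Notation biv F := {poly {poly F}}.
Notation cst c := (c%:P%:P).
Notation bx := ('X%:P).

Section Substitution.
Variables (F : fieldType) (A : comNzRingType) (iota : {rmorphism F -> A}).

(** An arbitrary target [A] lets the same substitutions serve as coordinate changes, as gradings and
    as composition with a parameter. *)
Definition sub1 (u : A) : {rmorphism {poly F} -> A} :=
  horner_morph (fun c => mulrC u (iota c)).

Definition sub2 (u v : A) : {rmorphism biv F -> A} :=
  horner_morph (fun c => mulrC v (sub1 u c)).

Lemma sub1C u c : sub1 u c%:P = iota c. Proof. exact: horner_morphC. Qed.
Lemma sub1X u : sub1 u 'X = u. Proof. exact: horner_morphX. Qed.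
Lemma sub2P u v a : sub2 u v a%:P = sub1 u a. Proof. exact: horner_morphC. Qed.
Lemma sub2C u v c : sub2 u v (cst c) = iota c. Proof. by rewrite sub2P sub1C. Qed.
Lemma sub2x u v : sub2 u v bx = u. Proof. by rewrite sub2P sub1X. Qed.
Lemma sub2y u v : sub2 u v 'X = v. Proof. exact: horner_morphX. Qed.
End Substitution.

Section Bivariate.
Variable F : fieldType.

Lemma biv_ind (K : biv F -> Prop) :
  (forall c, K (cst c)) -> K bx -> K 'X ->
  (forall a b, K a -> K b -> K (a + b)) -> (forall a b, K a -> K b -> K (a * b)) ->
  forall b, K b.
Proof.
move=> Kc Kx Ky KD KM; elim/poly_ind => [|p c IH]; first exact: (Kc 0).
apply: (KD); first exact: (KM).
elim/poly_ind: c => [|a c IHa]; first exact: (Kc 0).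
by rewrite polyCD polyCM; apply: KD => //; apply: (KM).
Qed.

Lemma biv_morph_eq (A : nzRingType) (f g : {rmorphism biv F -> A}) :
  (forall c, f (cst c) = g (cst c)) -> f bx = g bx -> f 'X = g 'X -> f =1 g.
Proof.
move=> hc hx hy; elim/biv_ind => // a b ea eb; first by rewrite !rmorphD ea eb.
by rewrite !rmorphM ea eb.
Qed.

Definition dx (b : biv F) : biv F := map_poly (@deriv F) b.
Definition dy (b : biv F) : biv F := b^`().
Definition bracket (a b : biv F) := dx a * dy b - dy a * dx b.

Lemma dxD : {morph dx : a b / a + b}. Proof. exact: raddfD. Qed.
Lemma dxM a b : dx (a * b) = dx a * b + a * dx b.
Proof.
apply/polyP => k; rewrite coefD coef_map coefM !coefM /= raddf_sum -big_split /=.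
by apply: eq_bigr => i _; rewrite derivM !coef_map.
Qed.
Lemma dxC c : dx (cst c) = 0. Proof. by rewrite /dx map_polyC /= derivC. Qed.
Lemma dxx : dx bx = 1. Proof. by rewrite /dx map_polyC /= derivX. Qed.
Lemma dxy : dx 'X = 0.
Proof. by apply/polyP => k; rewrite coef_map coefX coef0 /=; case: eqP; rewrite ?(derivC 1) ?deriv0 //= -[X in X^`()]polyC1 derivC. Qed.
Lemma dyD : {morph dy : a b / a + b}. Proof. exact: derivD. Qed.
Lemma dyM a b : dy (a * b) = dy a * b + a * dy b. Proof. exact: derivM. Qed.
Lemma dyC c : dy (cst c) = 0. Proof. exact: derivC. Qed.
Lemma dyx : dy bx = 0. Proof. exact: derivC. Qed.
Lemma dyy : dy 'X = 1. Proof. exact: derivX. Qed.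

Lemma coef_dx b j i : (dx b)`_j`_i = b`_j`_i.+1 *+ i.+1.
Proof. by rewrite coef_map coef_deriv. Qed.
Lemma coef_dy b j i : (dy b)`_j`_i = b`_j.+1`_i *+ j.+1.
Proof. by rewrite coef_deriv coefMn. Qed.

Definition dE := (dxD, dxM, dxC, dxx, dxy, dyD, dyM, dyC, dyx, dyy).

Lemma bracketE a b : bracket a b = dx a * dy b - dy a * dx b. Proof. by []. Qed.

Lemma bracketDr a b c : bracket a (b + c) = bracket a b + bracket a c.
Proof. by rewrite /bracket !dE; ring. Qed.
Lemma bracketMr a b c : bracket a (b * c) = bracket a b * c + b * bracket a c.
Proof. by rewrite /bracket !dE; ring. Qed.
Lemma bracketrr a : bracket a a = 0.
Proof. by rewrite /bracket; ring. Qed.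
Lemma bracketrC a c : bracket a (cst c) = 0.
Proof. by rewrite /bracket !dE; ring. Qed.

Section Endomorphism.
Variable s : {rmorphism biv F -> biv F}.
Hypothesis sC : forall c, s (cst c) = cst c.

Lemma dx_endo b : dx (s b) = s (dx b) * dx (s bx) + s (dy b) * dx (s 'X).
Proof.
elim/biv_ind: b => [c|||a b ea eb|a b ea eb].
- by rewrite sC !dE rmorph0 !mul0r addr0.
- by rewrite !dE rmorph0 rmorph1 mul1r mul0r addr0.
- by rewrite !dE rmorph0 rmorph1 mul1r mul0r add0r.
- by rewrite !dE !rmorphD dxD ea eb; ring.
- by rewrite !dE !rmorphD !rmorphM dxM ea eb; ring.
Qed.

Lemma dy_endo b : dy (s b) = s (dx b) * dy (s bx) + s (dy b) * dy (s 'X).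
Proof.
elim/biv_ind: b => [c|||a b ea eb|a b ea eb].
- by rewrite sC !dE rmorph0 !mul0r addr0.
- by rewrite !dE rmorph0 rmorph1 mul1r mul0r addr0.
- by rewrite !dE rmorph0 rmorph1 mul1r mul0r add0r.
- by rewrite !dE !rmorphD dyD ea eb; ring.
- by rewrite !dE !rmorphD !rmorphM dyM ea eb; ring.
Qed.

Lemma bracket_endo a b : bracket (s a) (s b) = s (bracket a b) * bracket (s bx) (s 'X).
Proof.
rewrite /bracket (dx_endo a) (dx_endo b) (dy_endo a) (dy_endo b) rmorphB !rmorphM; ring.
Qed.

Hypothesis sK : involutive s.

(** The chain rule for [s] composed with itself gives [s J * J = 1], so [J] is a unit of the
    polynomial ring, that is, a nonzero constant. *)
Lemma jacobian_involution : exists2 j : F, j != 0 & bracket (s bx) (s 'X) = cst j.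
Proof.
set J := bracket _ _.
have JJ : s J * J = 1.
  by rewrite -bracket_endo !sK /bracket !dE; ring.
have : J \is a GRing.unit by apply/unitrPr; exists (s J); rewrite mulrC.
rewrite poly_unitE => /andP[/eqP sJ]; rewrite poly_unitE => /andP[/eqP sj uj].
exists J`_0`_0; first by move: uj; rewrite unitfE.
by rewrite {1}(size1_polyC (eq_leq sJ)) {1}(size1_polyC (eq_leq sj)).
Qed.

Definition nilp (a b : biv F) := exists n, iter n (bracket a) b = 0.

Lemma bracketr0 a : bracket a 0 = 0. Proof. exact: (bracketrC a 0). Qed.

Lemma iter_bracket0 a n : iter n (bracket a) 0 = 0.
Proof. by elim: n => //= n ->; rewrite bracketr0. Qed.

Lemma iter_bracketD a n b c :
  iter n (bracket a) (b + c) = iter n (bracket a) b + iter n (bracket a) c.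
Proof. by elim: n => //= n ->; rewrite bracketDr. Qed.

(* The bracket with [s a] is, up to the constant Jacobian, the conjugate by [s] of that with [a]. *)
Lemma nilp_involution a : (forall b, nilp a b) -> forall b, nilp (s a) b.
Proof.
move=> na b; have [n] := na (s b); have [j _ jE] := jacobian_involution.
move=> h; exists n; have: forall m, iter m (bracket (s a)) b = cst (j ^+ m) * s (iter m (bracket a) (s b)).
  elim=> [|m IH]; first by rewrite /= sK mul1r.
  rewrite iterS IH bracketMr bracketrC mul0r add0r.
  by rewrite bracket_endo jE iterS exprS !polyCM; ring.
by move=> ->; rewrite h rmorph0 mulr0.
Qed.
End Endomorphism.

(* Leibniz rule for iterates, in the range where only one term survives. *)
Lemma iter_bracketM e n m a b :
  iter n.+1 (bracket e) a = 0 -> iter m.+1 (bracket e) b = 0 ->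
  iter (n + m) (bracket e) (a * b) =
    (iter n (bracket e) a * iter m (bracket e) b) *+ 'C(n + m, n)
  /\ iter (n + m).+1 (bracket e) (a * b) = 0.
Proof.
(* Induction on a bound for the sum of the orders: one bracket splits [a * b] into two products of
   smaller order, and Pascal's rule adds their binomial coefficients. *)
move: {2}(n + m)%N (leqnn (n + m)) => N; elim: N n m a b => [|N IH] n m a b.
  rewrite leqn0 addn_eq0 => /andP[/eqP -> /eqP ->] /= ea eb.
  by rewrite bin0 bracketMr ea eb !(mul0r, mulr0) addr0.
case: n => [|n]; case: m => [|m] le_nm ea eb.
- by rewrite /= in ea eb *; rewrite bin0 bracketMr ea eb !(mul0r, mulr0) addr0.
- have ea0 : bracket e a = 0 by [].
  have [] := IH 0%N m a (bracket e b) le_nm ea; first by rewrite -iterSr.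
  rewrite !add0n !bin0 !mulr1n => h1 h2.
  have st : bracket e (a * b) = a * bracket e b by rewrite bracketMr ea0 mul0r add0r.
  by split; rewrite iterSr st // h1 -iterSr.
- have eb0 : bracket e b = 0 by [].
  have ea1 : iter n.+1 (bracket e) (bracket e a) = 0 by rewrite -iterSr.
  have le_n : (n + 0 <= N)%N by lia.
  have [] := IH n 0%N (bracket e a) b le_n ea1 eb; rewrite ?addn0.
  rewrite !binn !mulr1n => h1 h2.
  have st : bracket e (a * b) = bracket e a * b by rewrite bracketMr eb0 mulr0 addr0.
  by split; rewrite iterSr st // h1 -iterSr.
have ea1 : iter n.+1 (bracket e) (bracket e a) = 0 by rewrite -iterSr.
have eb1 : iter m.+1 (bracket e) (bracket e b) = 0 by rewrite -iterSr.
have le1 : (n + m.+1 <= N)%N by lia.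
have le2 : (n.+1 + m <= N)%N by lia.
have [h1 h2] := IH n m.+1 (bracket e a) b le1 ea1 eb.
have [] := IH n.+1 m a (bracket e b) le2 ea eb1.
have -> : (n.+1 + m = n + m.+1)%N by lia.
move=> h3 h4.
have st : bracket e (a * b) = bracket e a * b + a * bracket e b by rewrite bracketMr.
split.
  have -> : (n.+1 + m.+1 = (n + m.+1).+1)%N by lia.
  rewrite iterSr st iter_bracketD h1 h3 -!iterSr -mulrnDr binS addnC.
  by congr (_ *+ _).
have -> : (n.+1 + m.+1 = (n + m.+1).+1)%N by lia.
by rewrite iterSr st iter_bracketD h2 h4 addr0.
Qed.
End Bivariate.

#[global] Opaque dx dy bracket.

(** * Locally nilpotent brackets and leading forms *)

Section NilpotencyDegree.
Variable F : numFieldType.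
Implicit Types a b e : biv F.

(** The degree function of a locally nilpotent derivation: zero on nonzero kernel elements and, in
    characteristic zero, additive on products. *)
Definition nildeg e n b :=
  iter n (bracket e) b != 0 /\ iter n.+1 (bracket e) b = 0.

Lemma iter_bracket_le e n m b : (n <= m)%N ->
  iter n (bracket e) b = 0 -> iter m (bracket e) b = 0.
Proof. by move=> /subnK <- h; rewrite iterD h iter_bracket0. Qed.

Lemma natr_biv_neq0 n : (0 < n)%N -> (n%:R : biv F) != 0.
Proof. by move=> n0; rewrite -!polyC_natr !polyC_eq0 pnatr_eq0 -lt0n. Qed.

Lemma nildegM e n m a b :
  nildeg e n a -> nildeg e m b -> nildeg e (n + m) (a * b).
Proof.
move=> [na ea] [nb eb]; have [h1 h2] := iter_bracketM ea eb; split=> //.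
by rewrite h1 -mulr_natr !mulf_neq0 // natr_biv_neq0 // bin_gt0 leq_addr.
Qed.

Lemma nildeg_uniq e n m a : nildeg e n a -> nildeg e m a -> n = m.
Proof.
suff le n' m' : nildeg e n' a -> nildeg e m' a -> (n' <= m')%N.
  by move=> h1 h2; apply/eqP; rewrite eqn_leq !le.
move=> [h _] [_ h']; rewrite leqNgt; apply/negP => lt.
by move: h; rewrite (iter_bracket_le lt h') eqxx.
Qed.

Lemma nildeg_ex e a : nilp e a -> a != 0 -> exists n, nildeg e n a.
Proof.
case=> n; elim: n => [/= ->|n IH h a0]; first by rewrite eqxx.
by have [/IH|h'] := eqVneq (iter n (bracket e) a) 0; [apply | exists n].
Qed.

Lemma nildeg1 e : nildeg e 0 1.
Proof. by split; [exact: oner_neq0 | exact: (bracketrC e 1)]. Qed.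

Lemma nildegX e n a k : nildeg e n a -> nildeg e (k * n) (a ^+ k).
Proof.
move=> h; elim: k => [|k IH]; first by rewrite mul0n; exact: nildeg1.
by rewrite mulSn exprS; apply: nildegM.
Qed.

Lemma nildeg0 e a : a != 0 -> bracket e a = 0 -> nildeg e 0 a. Proof. by []. Qed.

Lemma nildegC e c : c != 0 -> nildeg e 0 (cst c).
Proof. by move=> c0; split; rewrite /= ?bracketrC // !polyC_eq0. Qed.

Lemma bracket_subr e a b : bracket e (a - b) = bracket e a - bracket e b.
Proof.
have -> : a - b = a + cst (-1) * b by rewrite !polyCN !polyC1; ring.
by rewrite bracketDr bracketMr bracketrC !polyCN !polyC1; ring.
Qed.

(** From the first bracket on, the iterates of [a] and [b] coincide. *)
Lemma nildeg_sub e n m a b :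
  bracket e (a - b) = 0 -> nildeg e n a -> nildeg e m b -> n = m.
Proof.
rewrite bracket_subr => /eqP; rewrite subr_eq0 => /eqP ab [na ea] [nb eb].
have ab' k : iter k.+1 (bracket e) a = iter k.+1 (bracket e) b.
  by elim: k => [|k IH]; [exact: ab | rewrite iterS IH].
case: (ltngtP n m) => // lt.
  by case/eqP: nb; apply: (iter_bracket_le lt); rewrite -(ab' n); exact: ea.
by case/eqP: na; apply: (iter_bracket_le lt); rewrite (ab' m); exact: eb.
Qed.

Lemma nilpD e a b : nilp e a -> nilp e b -> nilp e (a + b).
Proof.
move=> [n hn] [m hm]; exists (n + m)%N; rewrite iter_bracketD.
by rewrite !(iter_bracket_le _ hn, iter_bracket_le _ hm) ?leq_addr ?leq_addl ?addr0.
Qed.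

Lemma nilpM e a b : nilp e a -> nilp e b -> nilp e (a * b).
Proof.
move=> [n hn] [m hm]; exists (n + m).+1.
by apply: (iter_bracketM _ _).2; [apply: iter_bracket_le hn | apply: iter_bracket_le hm].
Qed.

Lemma nilp_gen e : nilp e bx -> nilp e 'X -> forall b, nilp e b.
Proof.
move=> hx hy; apply: biv_ind => //; [|exact: nilpD|exact: nilpM].
by move=> c; exists 1%N; rewrite /= bracketrC.
Qed.

Lemma nilp_bx b : nilp bx b.
Proof.
apply: nilp_gen; first by exists 1%N; apply: bracketrr.
exists 2%N => /=; have -> : bracket bx 'X = cst 1 :> biv F by rewrite bracketE !dE; ring.
exact: bracketrC.
Qed.

Lemma nilp_by b : nilp 'X b.
Proof.
apply: nilp_gen; last by exists 1%N; apply: bracketrr.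
exists 2%N => /=; have -> : bracket 'X bx = cst (-1) :> biv F.
  by rewrite bracketE !dE !polyCN; ring.
exact: bracketrC.
Qed.

(** The kernel is factorially closed: the degrees of the two factors add up to zero. *)
Lemma kernel_factor e a b : (forall c, nilp e c) ->
  a * b != 0 -> bracket e (a * b) = 0 -> bracket e a = 0 /\ bracket e b = 0.
Proof.
move=> ne ab0 hab; have [a0 b0] : a != 0 /\ b != 0.
  by move: ab0; rewrite mulf_eq0 negb_or => /andP.
have [[n hn] [m hm]] := (nildeg_ex (ne a) a0, nildeg_ex (ne b) b0).
have := nildeg_uniq (nildeg0 ab0 hab) (nildegM hn hm).
by move/esym/eqP; rewrite addn_eq0 => /andP[/eqP n0 /eqP m0]; subst; case: hn hm => _ ? [].
Qed.

Lemma const_dxdy b : dx b = 0 -> dy b = 0 -> exists c, b = cst c.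
Proof.
move=> hx hy; exists b`_0`_0; apply/polyP => -[|j]; rewrite coefC /=; last first.
  apply/polyP => i; have /eqP := congr1 (fun p : biv F => p`_j`_i) hy.
  by rewrite coef_dy !coef0 -mulr_natr mulf_eq0 pnatr_eq0 orbF => /eqP.
apply/polyP => -[|i]; rewrite coefC //=.
have /eqP := congr1 (fun p : biv F => p`_0`_i) hx.
by rewrite coef_dx !coef0 -mulr_natr mulf_eq0 pnatr_eq0 orbF => /eqP.
Qed.
End NilpotencyDegree.

(** * Weighted gradings and leading forms *)

Section WeightedForms.
Variable F : fieldType.
Implicit Types a b e : biv F.

Lemma biv_monom_ind (K : biv F -> Prop) :
  K 0 -> (forall a b, K a -> K b -> K (a + b)) ->
  (forall c i j, K (cst c * bx ^+ i * 'X^j)) -> forall b, K b.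
Proof.
move=> K0 KD Km b; rewrite -[b]coefK poly_def; apply: (big_ind K) => // j _.
rewrite -mul_polyC -[b`_j]coefK poly_def raddf_sum mulr_suml; apply: (big_ind K) => // i _.
by rewrite /= -mul_polyC polyCM polyC_exp; apply: Km.
Qed.

Lemma coef_monom c i j k l :
  (cst c * bx ^+ i * 'X^j : biv F)`_k`_l = c *+ ((k == j) && (l == i)).
Proof.
rewrite -polyC_exp -polyCM coefCM coefXn; case: (k == j); last by rewrite mulr0 coef0.
by rewrite mulr1 coefCM coefXn; case: (l == i); rewrite ?mulr1 ?mulr0.
Qed.

Variables w1 w2 : nat.

Definition cst3 : {rmorphism F -> {poly biv F}} :=
  @polyC (biv F) \o (@polyC {poly F} \o @polyC F).
(* [b(x, y)] is sent to [b(t^w1 x, t^w2 y)], so that weighted leading forms are multiplicative. *)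
Definition grade : {rmorphism biv F -> {poly biv F}} :=
  sub2 cst3 ((bx : biv F)%:P * 'X^w1) (('X : biv F)%:P * 'X^w2).

Lemma coef_grade b k j i :
  (grade b)`_k`_j`_i = b`_j`_i *+ (w1 * i + w2 * j == k)%N.
Proof.
elim/biv_monom_ind: b => [|a b ea eb|c i' j'].
- by rewrite rmorph0 !coef0 mul0rn.
- by rewrite (rmorphD grade) !coefD ea eb mulrnDl.
have -> : grade (cst c * bx ^+ i' * 'X^j') =
    (cst c * bx ^+ i' * 'X^j')%:P * 'X^(w1 * i' + w2 * j').
  rewrite !rmorphM !rmorphXn /= sub2C sub2x sub2y /= !exprMn -!exprM exprD; ring.
rewrite coefCM coefXn; case: (eqVneq k _) => [->|ne].
  rewrite mulr1 coef_monom; case: (eqVneq j j') => [->|]; last by rewrite mul0rn.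
  by case: (eqVneq i i') => [->|]; rewrite ?eqxx ?mul0rn.
rewrite mulr0 !coef0 coef_monom; case: (eqVneq j j') => [->|]; last by rewrite mul0rn.
case: (eqVneq i i') => [->|]; last by rewrite mul0rn.
by rewrite eq_sym (negPf ne).
Qed.

Lemma grade_eq0 b : (grade b == 0) = (b == 0).
Proof.
apply/eqP/eqP => [h|->]; last exact: rmorph0.
apply/polyP => j; apply/polyP => i; have := coef_grade b (w1 * i + w2 * j) j i.
by rewrite h !coef0 eqxx.
Qed.

Definition wdeg b := (size (grade b)).-1.
Definition lead b := lead_coef (grade b).

(** Zero is homogeneous of every weight, which spares case distinctions on quotients. *)
Definition homog k e := forall i j, e`_j`_i != 0 -> (w1 * i + w2 * j = k)%N.

Lemma lead_eq0 b : (lead b == 0) = (b == 0).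
Proof. by rewrite lead_coef_eq0 grade_eq0. Qed.
Lemma leadM a b : lead (a * b) = lead a * lead b.
Proof. by rewrite /lead rmorphM lead_coefM. Qed.
Lemma wdegM a b : a != 0 -> b != 0 -> wdeg (a * b) = (wdeg a + wdeg b)%N.
Proof.
rewrite /wdeg -!grade_eq0 (rmorphM grade) => a0 b0; rewrite (size_mul a0 b0).
by rewrite -subn1 (polySpred a0) (polySpred b0) addnS subn1.
Qed.
Lemma coef_lead b j i : (lead b)`_j`_i = b`_j`_i *+ (w1 * i + w2 * j == wdeg b)%N.
Proof. by rewrite /lead lead_coefE coef_grade. Qed.
Lemma homog_coef_grade b k : homog k (grade b)`_k.
Proof.
by move=> i j; rewrite coef_grade; case: (eqVneq _ k) => [->|_] //; rewrite ?eqxx.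
Qed.
Lemma homog_lead b : homog (wdeg b) (lead b). Proof. exact: homog_coef_grade. Qed.

Lemma wdeg_ge b i j : b`_j`_i != 0 -> (w1 * i + w2 * j <= wdeg b)%N.
Proof.
move=> h; have := coef_grade b (w1 * i + w2 * j) j i; rewrite eqxx mulr1n => hc.
rewrite leqNgt; apply/negP => lt; move/eqP: h; apply.
have hs : (size (grade b) <= w1 * i + w2 * j)%N by move: lt; rewrite /wdeg; case: (size _).
by rewrite -hc [(grade b)`__]nth_default // !coef0.
Qed.

Lemma wdeg_le b k : (forall i j, b`_j`_i != 0 -> (w1 * i + w2 * j <= k)%N) -> (wdeg b <= k)%N.
Proof.
move=> h; rewrite /wdeg; suff: (size (grade b) <= k.+1)%N by case: (size _).
apply/leq_sizeP => l kl.
apply/polyP => j; apply/polyP => i; rewrite coef_grade !coef0.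
case: eqP => // el; have [//|/h] := eqVneq (b`_j`_i) 0; lia.
Qed.

Lemma wdeg_attained b : b != 0 -> exists i j, b`_j`_i != 0 /\ (w1 * i + w2 * j = wdeg b)%N.
Proof.
rewrite -lead_eq0 => h; apply: NNPP => hn; case/eqP: h.
apply/polyP => j; apply/polyP => i; rewrite coef_lead !coef0.
case: eqP => // e; apply/eqP; apply/negPn/negP => h; apply: hn; exists i, j.
by rewrite -e; split=> //; move: h; rewrite mulr1n.
Qed.

Lemma homogE k e : homog k e <-> grade e = e%:P * 'X^k.
Proof.
split=> [h|h i j].
  apply/polyP => l; rewrite coefCM coefXn; apply/polyP => j; apply/polyP => i.
  rewrite coef_grade; case: (eqVneq l k) => [->|ne]; rewrite ?mulr1 ?mulr0 ?coef0.
    by case: eqP => // ne; have [->|/h] := eqVneq (e`_j`_i) 0; rewrite ?mul0rn.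
  case: eqP => // el; have [//|/h] := eqVneq (e`_j`_i) 0; lia.
have := coef_grade e (w1 * i + w2 * j) j i; rewrite h eqxx coefCM coefXn mulr1n.
by case: eqP => // _; rewrite mulr0 !coef0 => <-; rewrite eqxx.
Qed.

Lemma wdeg_homog k e : e != 0 -> homog k e -> wdeg e = k.
Proof.
move=> e0 /homogE h; rewrite /wdeg h size_Cmul ?size_polyXn //.
Qed.

(** The bracket extended linearly over the grading variable, so that it applies to [grade a]. *)
Definition poly_bracket (u v : {poly biv F}) : {poly biv F} :=
  map_poly (@dx F) u * map_poly (@dy F) v - map_poly (@dy F) u * map_poly (@dx F) v.

Lemma coef_map_dx u k : (map_poly (@dx F) u)`_k = dx u`_k.
Proof. by apply: coef_map_id0; exact: (dxC 0). Qed.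
Lemma coef_map_dy u k : (map_poly (@dy F) u)`_k = dy u`_k.
Proof. by apply: coef_map_id0; exact: (dyC 0). Qed.

Lemma dx_grade b : map_poly (@dx F) (grade b) = 'X^w1 * grade (dx b).
Proof.
apply/polyP => k; rewrite coef_map_dx coefXnM; apply/polyP => j; apply/polyP => i.
rewrite coef_dx coef_grade; case: ltnP => lt.
  by rewrite !coef0; case: eqP => //; [lia | rewrite /= ?mulr0n ?mul0rn].
rewrite coef_grade coef_dx mulrnAC; congr (_ *+ _ *+ nat_of_bool _).
by apply/eqP/eqP; lia.
Qed.

Lemma dy_grade b : map_poly (@dy F) (grade b) = 'X^w2 * grade (dy b).
Proof.
apply/polyP => k; rewrite coef_map_dy coefXnM; apply/polyP => j; apply/polyP => i.
rewrite coef_dy coef_grade; case: ltnP => lt.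
  by rewrite !coef0; case: eqP => //; [lia | rewrite /= ?mulr0n ?mul0rn].
rewrite coef_grade coef_dy mulrnAC; congr (_ *+ _ *+ nat_of_bool _).
by apply/eqP/eqP; lia.
Qed.

(** Each derivative lowers the weight by that of its variable, hence the factor of degree
    [w1 + w2]. *)
Lemma grade_bracket a b :
  poly_bracket (grade a) (grade b) = 'X^(w1 + w2) * grade (bracket a b).
Proof.
rewrite /poly_bracket !dx_grade !dy_grade (rmorphB grade) !(rmorphM grade) exprD.
move: (grade (dx a)) (grade (dx b)) (grade (dy a)) (grade (dy b)) => u u' v v'; ring.
Qed.

Lemma coefM_top (u v : {poly biv F}) k l : (size u <= k.+1)%N -> (size v <= l.+1)%N ->
  (u * v)`_(k + l) = u`_k * v`_l.
Proof.
move=> su sv; rewrite coefM (bigD1 (Ordinal (leq_addr l k : k < (k + l).+1)%N)) //=.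
rewrite addKn big1 ?addr0 // => i; rewrite -val_eqE /= => ne.
have [lt|le] := ltnP k i; first by rewrite (leq_sizeP _ _ su) ?mul0r.
by rewrite [v`__](leq_sizeP _ _ sv) ?mulr0 //; lia.
Qed.

Lemma size_poly_bracket (u v : {poly biv F}) k l : (size u <= k.+1)%N -> (size v <= l.+1)%N ->
  (size (poly_bracket u v) <= (k + l).+1)%N.
Proof.
have szM (p q : {poly biv F}) : (size p <= size u)%N -> (size q <= size v)%N ->
    (size u <= k.+1)%N -> (size v <= l.+1)%N -> (size (p * q)%R <= (k + l).+1)%N.
  move=> hp hq su sv; apply: leq_trans (size_polyMleq _ _) _.
  move: (leq_trans hp su) (leq_trans hq sv); move: (size p) (size q) => m n; lia.
move=> su sv; rewrite (leq_trans (size_polyD _ _)) // geq_max size_polyN.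
by apply/andP; split; apply: szM => //; apply: size_poly.
Qed.

Lemma coef_poly_bracket (u v : {poly biv F}) k l : (size u <= k.+1)%N -> (size v <= l.+1)%N ->
  (poly_bracket u v)`_(k + l) = bracket u`_k v`_l.
Proof.
move=> su sv; rewrite coefB !coefM_top ?coef_map_dx ?coef_map_dy //;
  exact: leq_trans (size_poly _ _) _.
Qed.

Lemma poly_bracketXnM (u v : {poly biv F}) j :
  poly_bracket u ('X^j * v) = 'X^j * poly_bracket u v.
Proof.
have shift (f : biv F -> biv F) : f 0 = 0 -> map_poly f ('X^j * v) = 'X^j * map_poly f v.
  move=> f0; apply/polyP => i; rewrite coef_map_id0 // !coefXnM.
  by case: ifP => //; rewrite coef_map_id0.
have d0 : dx (0 : biv F) = 0 /\ dy (0 : biv F) = 0 by split; [exact: (dxC 0) | exact: (dyC 0)].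
rewrite /poly_bracket (shift _ d0.1) (shift _ d0.2) mulrBr.
by congr (_ - _); rewrite mulrCA.
Qed.

(** The coefficient of [t^(m k + l)] in the [m]-th iterated bracket of the graded polynomials is the
    [m]-th iterated bracket of the leading forms, whether or not it vanishes; so it is zero once the
    whole iterate is. *)
Lemma nilp_lead a b : nilp a b -> nilp (lead a) (lead b).
Proof.
case=> n h; exists n; set k := wdeg a; set l := wdeg b.
have sa : (size (grade a) <= k.+1)%N by apply: leqSpred.
have sb : (size (grade b) <= l.+1)%N by apply: leqSpred.
have step m : (size (iter m (poly_bracket (grade a)) (grade b)) <= (m * k + l).+1)%N /\
    (iter m (poly_bracket (grade a)) (grade b))`_(m * k + l) =
    iter m (bracket (lead a)) (lead b).
  elim: m => [|m [IH1 IH2]] //; rewrite !iterS mulSn -addnA; split.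
    exact: (size_poly_bracket sa IH1).
  by rewrite (coef_poly_bracket sa IH1) IH2.
have shift m : iter m (poly_bracket (grade a)) (grade b) =
    'X^(m * (w1 + w2)) * grade (iter m (bracket a) b).
  elim: m => [|m IH]; first by rewrite mul1r.
  by rewrite !iterS IH poly_bracketXnM grade_bracket mulrA -exprD mulSn addnC.
by have [_ <-] := step n; rewrite shift h rmorph0 mulr0 coef0.
Qed.
End WeightedForms.

(** * Homogeneous elements of the kernel *)

Section HomogeneousKernel.
Variable F : numClosedFieldType.
Implicit Types a b e h : biv F.

Definition ev b (u v : F) : F := b.[v%:P].[u].

Lemma evD a b u v : ev (a + b) u v = ev a u v + ev b u v.
Proof. by rewrite /ev !hornerD. Qed.
Lemma evN a u v : ev (- a) u v = - ev a u v.
Proof. by rewrite /ev !hornerN. Qed.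
Lemma evM a b u v : ev (a * b) u v = ev a u v * ev b u v.
Proof. by rewrite /ev !hornerM. Qed.
Lemma ev_monom c i j u v : ev (cst c * bx ^+ i * 'X^j) u v = c * u ^+ i * v ^+ j.
Proof. by rewrite evM evM /ev !(hornerC, hornerXn, horner_exp, hornerX). Qed.

Lemma monomial_or_root (r : {poly F}) : r != 0 ->
  (exists c n, r = c *: 'X^n) \/ exists2 z, z != 0 & root r z.
Proof.
move=> r0; have [s rE] := closed_field_poly_normal r.
have [s0|/allPn[z zs z0]] := boolP (all (pred1 0) s).
  left; exists (lead_coef r), (size s); rewrite {1}rE; congr (_ *: _).
  elim: s s0 {rE} => [_|z s IH /= /andP[/eqP -> /IH]]; first by rewrite big_nil.
  by rewrite big_cons subr0 exprS => ->.
right; exists z => //; rewrite rE rootZ ?lead_coef_eq0 //.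
by rewrite root_prod_XsubC.
Qed.

Variables p q : nat.
Hypotheses (p0 : (0 < p)%N) (q0 : (0 < q)%N).

Lemma homog_coef_inj k e i j j' : homog q p k e ->
  e`_j`_i != 0 -> e`_j'`_i != 0 -> j = j'.
Proof.
move=> he /he h1 /he h2; apply/eqP; rewrite -(eqn_pmul2l p0); apply/eqP; lia.
Qed.

Lemma eq_monom e i0 j0 : (forall i j, e`_j`_i != 0 -> i = i0 /\ j = j0) ->
  e = cst (e`_j0`_i0) * bx ^+ i0 * 'X^j0.
Proof.
move=> h; apply/polyP => j; apply/polyP => i; rewrite coef_monom.
have [e0|/h[-> ->]] := eqVneq (e`_j`_i) 0; last by rewrite !eqxx.
rewrite e0; case: (eqVneq j j0) => [<-|//]; case: (eqVneq i i0) => [<-|//].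
by rewrite e0.
Qed.

(** Setting [y = 1] merges no monomials: in a fixed weight the exponent of [x] determines that of
    [y]. *)
Lemma coef_dehomog k e i j : homog q p k e ->
  e`_j`_i != 0 -> (e.[1])`_i = e`_j`_i.
Proof.
move=> he h; have js : (j < size e)%N.
  by rewrite ltnNge; apply: contra h => /(nth_default 0) ->; rewrite coef0.
rewrite horner_coef coef_sum (bigD1 (Ordinal js)) //= expr1n mulr1 big1 ?addr0 // => j'.
rewrite -val_eqE /= expr1n mulr1 => ne; apply: contraNeq ne => h'.
by apply/eqP; exact: (homog_coef_inj he h' h).
Qed.

Lemma dehomog_neq0 k e : homog q p k e -> e != 0 -> e.[1] != 0.
Proof.
move=> he e0; have [i [j [h _]]] := wdeg_attained q p e0.
by apply/eqP => r0; move: (h); rewrite -(coef_dehomog he h) r0 coef0 eqxx.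
Qed.

(** If [e(x, 1)] has no nonzero root [u], it is a monomial, and then so is [e]. *)
Lemma torus_root k e : homog q p k e -> e != 0 ->
  (exists c i j, c != 0 /\ e = cst c * bx ^+ i * 'X^j)
  \/ exists2 u, u != 0 & ev e u 1 = 0.
Proof.
move=> he e0; have [i [j [h _]]] := wdeg_attained q p e0.
case: (monomial_or_root (dehomog_neq0 he e0)) => [[c [n rn]]|[u u0 ru]]; last first.
  by right; exists u => //; apply/eqP; move: ru; rewrite /root /ev polyC1.
left; exists (e`_j`_i), i, j; split=> //; apply: eq_monom => i' j' h'.
have in' i1 j1 : e`_j1`_i1 != 0 -> i1 = n.
  move=> h1; move: (h1); rewrite -(coef_dehomog he h1) rn coefZ coefXn.
  by case: (eqVneq i1 n) => [//|_]; rewrite /= mulr0 eqxx.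
have ii : i' = i by rewrite (in' _ _ h') (in' _ _ h).
by split=> //; subst i'; exact: (homog_coef_inj he h' h).
Qed.

(** Homogeneous of weight [p q], as [x] has weight [q] and [y] has weight [p]. *)
Definition wbinom (g : F) : biv F := bx ^+ p - cst g * 'X^q.

Lemma homogZ k e c : homog q p k e -> homog q p k (cst c * e).
Proof.
by move=> he i j; rewrite coefCM coefCM mulf_eq0 negb_or => /andP[_ /he].
Qed.

Lemma homog_monom k c i j : (q * i + p * j = k)%N ->
  homog q p k (cst c * bx ^+ i * 'X^j : biv F).
Proof.
move=> ijk i' j'; rewrite coef_monom; case: (eqVneq j' j) => [->|_]; last by rewrite eqxx.
by case: (eqVneq i' i) => [->|_]; rewrite ?eqxx.
Qed.

Lemma homogD k a b : homog q p k a -> homog q p k b -> homog q p k (a + b).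
Proof.
move=> ha hb i j; rewrite !coefD; have [->|/ha //] := eqVneq (a`_j`_i) 0.
by rewrite add0r => /hb.
Qed.

Hypothesis pq : coprime p q.

(* Divide by the binomial, monic in [y] up to a constant: the homogeneous remainder has degree
   [< q] in [y], so by coprimality it is a monomial, which has no zero on the torus. *)
Lemma wbinom_dvd k e u v : homog q p k e -> u != 0 -> v != 0 -> ev e u v = 0 ->
  let g := u ^+ p / v ^+ q in
  g != 0 /\ exists h, homog q p (k - p * q) h /\ e = wbinom g * h.
Proof.
move=> he u0 v0 euv g; have g0 : g != 0 by rewrite mulf_neq0 ?invr_eq0 ?expf_neq0.
(* [d] is [wbinom g] divided by [- g], hence monic in [y]. *)
split=> //; set d : biv F := 'X^q - (g^-1 *: 'X^p)%:P.
have dmon : d \is monic by apply: monicXnsubC.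
have dsz : size d = q.+1 by apply: size_XnsubC.
have dhom : homog q p (p * q) d.
  have -> : d = cst 1 * bx ^+ 0 * 'X^q + cst (- g^-1) * bx ^+ p * 'X^0.
    by rewrite /d -mul_polyC polyCM polyC_exp !polyCN !polyC1; ring.
  by apply: homogD; apply: homog_monom; rewrite ?muln0 // addn0 mulnC.
pose h0 := e %/ d; pose r := e %% d.
have eE : e = h0 * d + r by apply: Pdiv.IdomainMonic.divp_eq.
have rsz : (size r <= q)%N by rewrite -ltnS -dsz ltn_modpN0 // monic_neq0.
(* Homogeneity of quotient and remainder is obtained by keeping only the component of weight [k] of
   the division identity. *)
pose r' := (grade F q p r)`_k.
have [h' [hh' e']] : exists h', homog q p (k - p * q) h' /\ e = h' * d + r'.
  have /homogE ge := he; have /homogE gd := dhom.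
  have ek : e = (grade F q p e)`_k by rewrite ge coefCM coefXn eqxx mulr1.
  rewrite {1}ek {1}eE (rmorphD (grade F q p)) (rmorphM (grade F q p)) gd coefD mulrA.
  rewrite coefMXn [(grade F q p h0 * _)`__]coefMC -/r'.
  case: ltnP => _; last by exists (grade F q p h0)`_(k - p * q); split=> //; apply: homog_coef_grade.
  (* For [k < p q] the difference [k - p q] is truncated, but then the quotient contributes nothing
     and [0] serves. *)
  by exists 0; split; [move=> i j; rewrite !coef0 eqxx | rewrite mul0r].
have r'0 : r' = 0.
  apply/eqP/negPn/negP => r'0; have [i0 [j0 [h _]]] := wdeg_attained q p r'0.
  have lt_j i j : r'`_j`_i != 0 -> (j < q)%N.
    rewrite coef_grade ltnNge; apply: contra => /(leq_trans rsz) /(nth_default 0) ->.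
    by rewrite coef0 mul0rn.
  have rhom : homog q p k r' by apply: homog_coef_grade.
  have r'E : r' = cst (r'`_j0`_i0) * bx ^+ i0 * 'X^j0.
    apply: eq_monom => i j hij; have jj : j = j0.
      have ltj := lt_j _ _ hij; have ltj0 := lt_j _ _ h.
      have E : (q * i + p * j = q * i0 + p * j0)%N by rewrite (rhom _ _ hij) (rhom _ _ h).
      have inj (a b a' b' : nat) : (b' <= b)%N -> (b < q)%N -> (q * a + p * b = q * a' + p * b')%N -> b = b'.
        move=> le_b lt_b ab; have : (q %| p * (b - b'))%N.
          by apply/dvdnP; exists (a' - a)%N; rewrite mulnBr mulnBl ![(_ * q)%N]mulnC; lia.
        rewrite Gauss_dvdr; last by rewrite coprime_sym.
        by move/dvdnP=> [[|n]]; rewrite ?mulSn; lia.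
      case: (leqP j0 j) => [le|/ltnW le]; first exact: (inj i j i0 j0).
      by symmetry; apply: (inj i0 j0 i j).
    split=> //; subst j; apply/eqP; rewrite -(eqn_pmul2l q0); apply/eqP.
    by have := rhom _ _ hij; have := rhom _ _ h; lia.
  have dv : ev d u v = 0.
    rewrite /d evD evN /ev hornerXn hornerC -polyC_exp hornerC hornerZ hornerXn.
    by rewrite /g invf_div divfK ?expf_neq0 // subrr.
  have : ev r' u v = 0 by move: euv; rewrite e' evD evM dv mulr0 add0r.
  rewrite r'E ev_monom => /eqP; rewrite !mulf_eq0 !expf_eq0 (negPf u0) (negPf v0) !andbF !orbF.
  by apply/negP.
exists (cst (- g^-1) * h'); split; first exact: homogZ.
rewrite e' r'0 addr0 /wbinom /d -mul_polyC polyCM polyC_exp !polyCN.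
have gg : cst g * cst g^-1 = 1 :> biv F by rewrite -!polyCM mulfV.
have -> : (bx ^+ p - cst g * 'X^q) * (- cst g^-1 * h') =
   h' * (cst g * cst g^-1 * 'X^q - cst g^-1 * bx ^+ p) :> biv F by ring.
by rewrite gg mul1r.
Qed.

Lemma ev_const_eq0 c u v : ev (cst c) u v = c.
Proof. by rewrite /ev !hornerC. Qed.

Section Kernel.
Variables (k : nat) (e0 : biv F) (u v : F).
Hypotheses (nil0 : forall b, nilp e0 b) (hom0 : homog q p k e0) (e00 : e0 != 0).
Hypotheses (u0 : u != 0) (v0 : v != 0) (e0uv : ev e0 u v = 0).

(* Factors of kernel elements are in the kernel, and two distinct binomials cannot both be, since
   [y] is not. Comparing nilpotency degrees [nx], [ny] of [x], [y] in [x^p - g y^q] and in the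
   image of [y] gives [p nx = q ny] and [ny - 1 = (p - 1) nx], whence [p = 1]. *)
Lemma kernel_binom : (p <= q)%N ->
  p = 1%N /\ exists2 g, g != 0 & forall l e, homog q p l e -> e != 0 ->
    bracket e0 e = 0 -> exists c m, c != 0 /\ e = cst c * wbinom g ^+ m.
Proof.
have [nx dgx] : exists n, nildeg e0 n bx by apply: nildeg_ex; rewrite // polyC_eq0 polyX_eq0.
have [ny dgy] : exists n, nildeg e0 n 'X by apply: nildeg_ex; rewrite // polyX_eq0.
set g := u ^+ p / v ^+ q.
have [g0 [h0 [_ e0E]]] := wbinom_dvd hom0 u0 v0 e0uv.
rewrite -/g in g0 e0E.
have gker : bracket e0 (wbinom g) = 0.
  have e0n : wbinom g * h0 != 0 by rewrite -e0E.
  have e0b : bracket e0 (wbinom g * h0) = 0 by rewrite -e0E bracketrr.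
  by have [] := kernel_factor nil0 e0n e0b.
have dgxp : nildeg e0 (p * nx) (bx ^+ p) by apply: nildegX.
have dgyq c : c != 0 -> nildeg e0 (q * ny) (cst c * 'X^q).
  by move=> c0; rewrite -[(q * ny)%N]add0n; apply: nildegM; [apply: nildegC | apply: nildegX].
have pnqn : (p * nx = q * ny)%N by apply: nildeg_sub gker _ _ => //; apply: dgyq.
(* Otherwise [nx = 0] too, so both derivatives of [e0] vanish and [e0] is a constant, which its zero
   on the torus makes [0]. *)
have ny0 : (0 < ny)%N.
  rewrite lt0n; apply/negP => /eqP ny0; have nx0 : nx = 0%N by move: pnqn; rewrite ny0; lia.
  move: dgx dgy; rewrite nx0 ny0 => -[_ hx'] [_ hy'].
  have hx : bracket e0 bx = 0 := hx'; have hy : bracket e0 'X = 0 := hy'.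
  have [c cE] : exists c, e0 = cst c.
    apply: const_dxdy.
      by move: hy; rewrite bracketE !dE mulr1 mulr0 subr0.
    by move: hx; rewrite bracketE !dE mulr1 mulr0 sub0r => /eqP; rewrite oppr_eq0 => /eqP.
  by move: e0uv e00; rewrite cE ev_const_eq0 => ->; rewrite eqxx.
(* Induction on the weight, removing one binomial factor at a time. It ends at a monomial, which
   lies in the kernel only if constant, as [nx] and [ny] are positive. *)
have ker l e : homog q p l e -> e != 0 -> bracket e0 e = 0 ->
    exists c m, c != 0 /\ e = cst c * wbinom g ^+ m.
  elim/ltn_ind: l e => l IH e he ne ke.
  case: (torus_root he ne) => [[c [i [j [c0 eE]]]]|[z z0 ez]].
    have dge : nildeg e0 (i * nx + j * ny) e.
      rewrite eE -[(i * nx)%N]add0n; apply: nildegM; last exact: nildegX.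
      by apply: nildegM; [apply: nildegC | apply: nildegX].
    have := nildeg_uniq dge (nildeg0 ne ke) => /eqP.
    rewrite addn_eq0 !muln_eq0 !(gtn_eqF ny0) (_ : (nx == 0)%N = false); last by apply/eqP; lia.
    rewrite !orbF => /andP[/eqP i0 /eqP j0]; exists c, 0%N; split=> //.
    by rewrite eE i0 j0 !expr0 !mulr1.
  have [g'0 [h [hh eE]]] := wbinom_dvd he z0 (oner_neq0 F) ez.
  set g' := z ^+ p / _ in g'0 eE.
  have [kg' kh] : bracket e0 (wbinom g') = 0 /\ bracket e0 h = 0.
    by rewrite eE in ne ke; apply: (kernel_factor nil0 ne ke).
  have gg : g' = g.
    apply/eqP; rewrite -subr_eq0; apply/negPn/negP => ne'.
    have : bracket e0 (cst (g' - g) * 'X^q) = 0.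
      have -> : cst (g' - g) * 'X^q = wbinom g - wbinom g'.
        by rewrite /wbinom !polyCB; ring.
      by rewrite bracket_subr gker kg' subrr.
    have [_ nz] := dgyq _ ne'; move=> zz.
    have nz0 : cst (g' - g) * 'X^q != 0 :> biv F.
      by rewrite mulf_neq0 ?polyC_eq0 // ?polyC_eq0 // expf_neq0 // polyX_eq0.
    have := nildeg_uniq (dgyq _ ne') (nildeg0 nz0 zz); move/eqP.
    by rewrite muln_eq0 !gtn_eqF.
  have nh : h != 0 by apply: contraNneq ne => h_0; rewrite eE h_0 mulr0.
  have lpq : (0 < l)%N.
    rewrite lt0n; apply/negP => /eqP l0; move: ez; have [i [j [hij _]]] := wdeg_attained q p ne.
    have ij i' j' : e`_j'`_i' != 0 -> i' = 0%N /\ j' = 0%N by move/he; rewrite l0; lia.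
    rewrite (eq_monom ij) ev_monom !expr0 !mulr1; case: (ij _ _ hij) => i0 j0.
    by move: hij; rewrite i0 j0 => /eqP.
  have [|c [m [c0 hE]]] := IH (l - p * q)%N _ h hh nh kh.
    by rewrite ltn_subrL muln_gt0 p0 q0.
  by exists c, m.+1; split=> //; rewrite eE hE gg exprS; ring.
move=> le_pq; split; last by exists g.
have [c [m [c0 e0m]]] := ker k e0 hom0 e00 (bracketrr e0).
have m0 : (0 < m)%N.
  rewrite lt0n; apply/negP => /eqP m0; move: e0uv.
  by rewrite e0m m0 expr0 mulr1 ev_const_eq0; apply/eqP.
have dxX n b : dx (b ^+ n) = n%:R * b ^+ n.-1 * dx b.
  elim: n => [|n IH]; first by rewrite expr0 mul0r mul0r (dxC 1).
  rewrite exprS dxM IH /=; case: n {IH} => [|n]; first by rewrite expr0 mul0r mul0r mulr0 addr0; ring.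
  rewrite /= exprS -[in RHS]natr1; ring.
have bry : bracket e0 'X = cst (c * m%:R * p%:R) * wbinom g ^+ m.-1 * bx ^+ p.-1.
  rewrite bracketE !dE mulr0 subr0 mulr1 e0m dxM dxC mul0r add0r dxX.
  have -> : dx (wbinom g) = p%:R * bx ^+ p.-1.
    by rewrite /wbinom -mulNr -!polyCN dxD dxX dxx dxM dxC dxX dxy; ring.
  by rewrite !polyCM !polyC_natr; ring.
have dgb : nildeg e0 (p.-1 * nx) (bracket e0 'X).
  rewrite bry -[(p.-1 * nx)%N]add0n; apply: nildegM; last exact: nildegX.
  rewrite -[0%N]addn0; apply: nildegM.
    by apply: nildegC; rewrite !mulf_neq0 // pnatr_eq0 -lt0n.
  by rewrite -[0%N](muln0 m.-1); apply: nildegX; split=> //; rewrite /=;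
    apply/eqP => w0; move: e00; rewrite e0E w0 mul0r eqxx.
have nyE : (ny.-1 = p.-1 * nx)%N.
  apply: nildeg_uniq dgb; case: dgy => h1 h2; split.
    by rewrite -iterSr prednK.
  by rewrite -iterSr prednK.
(* If [p >= 2] then [q (p - 1) >= p], and [p nx = q ny = q + q (p - 1) nx] would exceed [p nx]. *)
nia.
Qed.
End Kernel.
End HomogeneousKernel.

(** * Prime ideals of the plane *)

Lemma nat_minimum (K : nat -> Prop) : (exists n, K n) ->
  exists n, K n /\ forall m, K m -> (n <= m)%N.
Proof.
case=> n; elim/ltn_ind: n => n IH Kn.
case: (classic (exists2 m, K m & (m < n)%N)) => [[m Km /IH]|h]; first exact.
by exists n; split=> // m Km; rewrite leqNgt; apply/negP => lt; apply: h; exists m.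
Qed.

Lemma min_measure (T : Type) (K : T -> Prop) (mu : T -> nat) : (exists x, K x) ->
  exists2 x, K x & forall y, K y -> (mu x <= mu y)%N.
Proof.
case=> x Kx; have [|n [[y [Ky <-]] h]] := @nat_minimum (fun n => exists y, K y /\ mu y = n).
  by exists (mu x), x.
by exists y => // z Kz; apply: h; exists z.
Qed.

Section PrimeIdeal.
Variable F : numClosedFieldType.
Implicit Types a b e f : biv F.

Record prime_ideal (I : biv F -> Prop) : Prop := PrimeIdeal {
  idealD : forall a b, I a -> I b -> I (a + b);
  idealM : forall a b, I b -> I (a * b);
  ideal_prime : forall a b, I (a * b) -> I a \/ I b;
  ideal_proper : ~ I 1 }.

Section Ideal.
Variable I : biv F -> Prop.
Hypothesis pI : prime_ideal I.

Lemma ideal0 a : I a -> I 0.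
Proof. by move=> h; rewrite -(mul0r a); apply: idealM. Qed.
Lemma idealB a b : I a -> I b -> I (a - b).
Proof. by move=> ha hb; apply: idealD => //; rewrite -mulN1r; apply: idealM. Qed.
Lemma ideal_cst c : c != 0 -> ~ I (cst c).
Proof.
move=> c0 h; apply: (ideal_proper pI).
by have := idealM pI (cst c^-1) h; rewrite -!polyCM mulVf.
Qed.

(* Restriction to the line [x = c]. *)
Definition on_line c : {rmorphism biv F -> {poly F}} := map_poly (horner_eval c).

Lemma on_line_eq0 c a : on_line c a = 0 -> exists a', a = ('X - c%:P)%:P * a'.
Proof.
move=> h; exists (map_poly (fun r => r %/ ('X - c%:P)) a).
apply/polyP => j; rewrite coefCM coef_map_id0 ?div0p // mulrC divpK //.
rewrite dvdp_XsubCl /root; apply/eqP.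
by have := congr1 (fun r : {poly F} => r`_j) h; rewrite coef_map coef0.
Qed.

(* Pseudo-divide by an element [f] of minimal degree in [y] and then minimal leading coefficient,
   and cancel the linear factors of the multiplier one by one: none divides [f]. *)
Lemma ideal_principal : (forall c, ~ I (bx - cst c)) -> (exists2 f, f != 0 & I f) ->
  exists f, [/\ f != 0, I f & forall b, I b -> exists e, b = f * e].
Proof.
move=> hx [f1 f10 If1].
have [|f2 [f20 If2] min2] := @min_measure _ (fun f => f != 0 /\ I f) (fun f => size f).
  by exists f1.
have [|f [f0 [If sf]] minf] := @min_measure _
  (fun f => f != 0 /\ (I f /\ size f = size f2)) (fun f => size (lead_coef f)).
  by exists f2.
exists f; split=> // b Ib; set k := scalp b f.
have eq1 := Pdiv.Idomain.divp_eq b f; rewrite -/k in eq1.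
have r0 : b %% f = 0.
  apply/eqP/negPn/negP => r0; have := ltn_modpN0 b f0.
  rewrite ltnNge sf min2 //; split=> //.
  have -> : b %% f = (lead_coef f ^+ k) *: b - b %/ f * f by rewrite eq1; ring.
  by apply: idealB; rewrite -?mul_polyC; apply: (idealM pI).
rewrite r0 addr0 in eq1.
have line_f c : on_line c f != 0.
  apply/eqP => /on_line_eq0 [f' fE]; move: (If); rewrite fE => If'.
  case: (ideal_prime pI If') => [|If1'].
    by rewrite polyCB; apply: hx.
  have f'0 : f' != 0 by apply: contraNneq f0 => f'0; rewrite fE f'0 mulr0.
  have xc0 : 'X - c%:P != 0 :> {poly F} by rewrite polyXsubC_eq0.
  have szf : size f = size f' by rewrite fE size_Cmul.
  have := minf f' (conj f'0 (conj If1' (etrans (esym szf) sf))).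
  rewrite fE lead_coefM lead_coefC size_mul ?lead_coef_eq0 // size_XsubC.
  by rewrite addSn add1n /= ltnn.
have: exists2 c, c != 0 & exists e, c *: b = f * e.
  exists (lead_coef f ^+ k); first by rewrite expf_neq0 // lead_coef_eq0.
  by exists (b %/ f); rewrite mulrC.
case=> c c0 [e]; have [n] := ubnP (size c); elim: n => // n IH in c c0 e * => szc cb.
have [/size_poly1P[c1 c10 cE]|/closed_rootP[z /factor_theorem[c' cE]]] := boolP (size c == 1%N).
  exists ((c1^-1)%:P *: e); rewrite -scalerAr -cb scalerA cE -polyCM mulVf //.
  by rewrite polyC1 scale1r.
have c'0 : c' != 0 by apply: contraNneq c0 => c'0; rewrite cE c'0 mul0r.
have : on_line z e = 0.
  apply/eqP; have := congr1 (on_line z) cb; rewrite rmorphM -mul_polyC rmorphM /= => h.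
  have : on_line z c%:P = 0.
    by rewrite /on_line /= map_polyC /= /horner_eval cE hornerM hornerXsubC subrr mulr0.
  move=> h0; move: h; rewrite h0 mul0r => /esym/eqP.
  by rewrite mulf_eq0 (negPf (line_f z)).
case/on_line_eq0 => e' eE; apply: (IH c' c'0 e').
  by move: szc; rewrite cE size_mul ?polyXsubC_eq0 // size_XsubC addn2.
have xz0 : ('X - z%:P)%:P != 0 :> biv F by rewrite polyC_eq0 polyXsubC_eq0.
apply: (mulfI xz0); rewrite mulrCA -eE -cb cE -!mul_polyC polyCM; ring.
Qed.

Definition cc : {rmorphism F -> biv F} := @polyC {poly F} \o @polyC F.

(** Says that the coordinate ring of the curve is generated by the class of one element [g]. *)
Definition rational_param (I : biv F -> Prop) :=
  exists g u v, I (bx - sub1 cc g u) /\ I ('X - sub1 cc g v).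

Lemma sub2_cong a a' b b' e : I (a - a') -> I (b - b') ->
  I (sub2 cc a b e - sub2 cc a' b' e).
Proof.
move=> ha hb; elim/biv_ind: e => [c|||e e' he he'|e e' he he'].
- by rewrite !sub2C subrr; apply: ideal0 ha.
- by rewrite !sub2x.
- by rewrite !sub2y.
- by rewrite !rmorphD opprD addrACA; apply: (idealD pI).
rewrite !rmorphM (_ : _ - _ = sub2 cc a b e * (sub2 cc a b e' - sub2 cc a' b' e') +
  sub2 cc a' b' e' * (sub2 cc a b e - sub2 cc a' b' e)); last by ring.
by apply: (idealD pI); apply: (idealM pI).
Qed.

Lemma sub2_id b : sub2 cc bx 'X b = b.
Proof.
have: sub2 cc bx 'X =1 (idfun : {rmorphism biv F -> biv F}).
  by apply: biv_morph_eq => *; rewrite /= ?sub2C ?sub2x ?sub2y.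
exact.
Qed.

(** A form of the property independent of the coordinates, used to transport it along a change of
    variables. *)
Lemma rational_param_all : rational_param I -> exists g, forall b, exists u, I (b - sub1 cc g u).
Proof.
case=> g [u [v [hx hy]]]; exists g => b; exists (sub2 (@polyC F) u v b).
have -> : sub1 cc g (sub2 (@polyC F) u v b) = sub2 cc (sub1 cc g u) (sub1 cc g v) b.
  have: (sub1 cc g \o sub2 (@polyC F) u v : {rmorphism biv F -> biv F})
      =1 sub2 cc (sub1 cc g u) (sub1 cc g v).
    apply: biv_morph_eq => [c||] /=.
    - by rewrite !sub2C sub1C.
    - by rewrite !sub2x.
    - by rewrite !sub2y.
  exact.
by rewrite -{1}[b]sub2_id; apply: sub2_cong.
Qed.

Lemma param_line c : I (bx - cst c) -> rational_param I.
Proof.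
move=> h; exists 'X, c%:P, 'X; rewrite sub1C sub1X subrr; split=> //.
exact: ideal0 h.
Qed.

Lemma param_graph c r : c != 0 -> I (cst c * bx + sub1 cc 'X r) -> rational_param I.
Proof.
move=> c0 h; exists 'X, (- c^-1 *: r), 'X; rewrite sub1X subrr.
split; last exact: ideal0 h.
rewrite -mul_polyC rmorphM sub1C /=.
have -> : bx - cst (- c^-1) * sub1 cc 'X r = cst c^-1 * (cst c * bx + sub1 cc 'X r).
  by rewrite mulrDr mulrA -!polyCM mulVf // !polyC1 !polyCN; ring.
exact: (idealM pI).
Qed.

(** A polynomial in [y] alone splits into linear factors, and primality puts one of them in [I]: the
    curve lies on a horizontal line. *)
Lemma param_y r : r != 0 -> I (sub1 cc 'X r) -> rational_param I.
Proof.
move=> r0; have [s ->] := closed_field_poly_normal r.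
rewrite -mul_polyC rmorphM sub1C => /(ideal_prime pI) [/ideal_cst|].
  by rewrite lead_coef_eq0.
elim: s => [|z s IH]; first by rewrite big_nil rmorph1 => /(ideal_proper pI).
rewrite big_cons rmorphM => /(ideal_prime pI) [|//].
rewrite rmorphB /= sub1X sub1C => h; exists bx, 'X, z%:P.
by rewrite sub1X sub1C subrr; split=> //; apply: ideal0 h.
Qed.
End Ideal.
End PrimeIdeal.

(** * Curves fixed by an involution of the plane *)

Section FixedCurve.
Variable F : numClosedFieldType.
Implicit Types a b e f : biv F.
Implicit Type I : biv F -> Prop.

(** Geometrically, [I] is the ideal of an irreducible closed subset of the plane on which a
    nontrivial involution is the identity. *)
Record fixed_prime (s : {rmorphism biv F -> biv F}) I : Prop := FixedPrime {
  fixed_cst : forall c, s (cst c) = cst c;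
  fixed_involutive : involutive s;
  fixed_nontrivial : exists b, s b != b;
  fixed_ideal : prime_ideal I;
  fixed_cong : forall b, I (b - s b) }.

Record coord_change (T T' : {rmorphism biv F -> biv F}) : Prop := CoordChange {
  change_cst : forall c, T (cst c) = cst c;
  change_cst' : forall c, T' (cst c) = cst c;
  changeK : cancel T T';
  changeK' : cancel T' T }.

Section Transport.
Variables (T T' : {rmorphism biv F -> biv F}) (hT : coord_change T T').

(** The ideal [T(I)] is expressed as the preimage of [I] under the inverse [T'], while [s] is
    conjugated by [T]. *)
Lemma fixed_prime_change s I : fixed_prime s I ->
  fixed_prime (T \o (s \o T')) (fun b => I (T' b)).
Proof.
case=> sc sK [b sb] pI sI; split=> [c|c|||c] /=.
- by rewrite (change_cst' hT) sc (change_cst hT).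
- by rewrite (changeK hT) sK (changeK' hT).
- exists (T b) => /=; rewrite (changeK hT); apply: contra sb => /eqP h.
  by rewrite -[s b](changeK hT) h (changeK hT).
- split=> [x y|x y|x y|].
  + by rewrite rmorphD; apply: (idealD pI).
  + by rewrite rmorphM; apply: (idealM pI).
  + by rewrite rmorphM; apply: (ideal_prime pI).
  + by rewrite rmorph1; apply: (ideal_proper pI).
- by rewrite rmorphB (changeK hT); apply: sI.
Qed.

Lemma generator_change I f : (forall b, I b -> exists e, b = f * e) ->
  forall b, I (T' b) -> exists e, b = T f * e.
Proof.
by move=> h b /h [e be]; exists (T e); rewrite -rmorphM -be (changeK' hT).
Qed.

Lemma rational_param_change I : prime_ideal (fun b => I (T' b)) ->
  rational_param (fun b => I (T' b)) -> rational_param I.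
Proof.
move=> pI /(rational_param_all pI) [g h].
have key b : exists u, I (b - sub1 (cc F) (T' g) u).
  have [u] := h (T b); rewrite rmorphB (changeK hT) => hu; exists u.
  suff -> : sub1 (cc F) (T' g) u = T' (sub1 (cc F) g u) by [].
  elim/poly_ind: u {hu} => [|u c IH]; first by rewrite !rmorph0.
  by rewrite !rmorphD !rmorphM /= !sub1X !sub1C IH [in RHS]/= (change_cst' hT).
by have [[u hu] [v hv]] := (key bx, key 'X); exists (T' g), u, v.
Qed.
End Transport.

Definition shear q (g : F) : {rmorphism biv F -> biv F} :=
  sub2 (cc F) (bx + cst g * 'X^q) 'X.
Definition swap : {rmorphism biv F -> biv F} := sub2 (cc F) 'X bx.

Lemma endo_id (T : {rmorphism biv F -> biv F}) : (forall c, T (cst c) = cst c) ->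
  T bx = bx -> T 'X = 'X -> T =1 id.
Proof.
move=> hc hx hy; have: T =1 (idfun : {rmorphism biv F -> biv F}) by apply: biv_morph_eq.
exact.
Qed.

Lemma shearK q g : cancel (shear q g) (shear q (- g)).
Proof.
apply: (endo_id (T := shear q (- g) \o shear q g)) => [c||] /=.
- by rewrite /shear !sub2C.
- by rewrite /shear sub2x rmorphD rmorphM rmorphXn /= sub2C sub2x sub2y /= !polyCN; ring.
- by rewrite /shear !sub2y.
Qed.

Lemma shear_change q g : coord_change (shear q g) (shear q (- g)).
Proof.
split=> [c|c||]; rewrite /shear ?sub2C //; first exact: shearK.
by rewrite -[X in cancel _ (shear q X)]opprK; apply: shearK.
Qed.

Lemma swap_change : coord_change swap swap.
Proof.
have K : cancel swap swap.
  by apply: (endo_id (T := swap \o swap)) => [c||] /=; rewrite /swap ?(sub2C, sub2x, sub2y).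
by split=> // c; rewrite /swap sub2C.
Qed.

Lemma coef_swap b i j : (swap b)`_j`_i = b`_i`_j.
Proof.
elim/biv_monom_ind: b => [|a b ea eb|c i' j']; first by rewrite rmorph0 !coef0.
  by rewrite rmorphD !coefD ea eb.
have -> : swap (cst c * bx ^+ i' * 'X^j') = cst c * bx ^+ j' * 'X^i'.
  by rewrite /swap !rmorphM !rmorphXn /= sub2C sub2x sub2y /=; ring.
by rewrite !coef_monom andbC.
Qed.

(** [x + g y^q] is homogeneous when [x] has weight [q] and [y] weight [1], so the shear respects
    this grading. *)
Lemma grade_shear q g b :
  grade F q 1 (shear q g b) = map_poly (shear q g) (grade F q 1 b).
Proof.
pose u : {rmorphism biv F -> {poly biv F}} := grade F q 1 \o shear q g.
pose v : {rmorphism biv F -> {poly biv F}} := map_poly (shear q g) \o grade F q 1.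
suff uv : u =1 v by exact: (uv b).
apply: biv_morph_eq => [c||] /=; rewrite /shear.
- by rewrite sub2C /= /grade !sub2C /= map_polyC /= sub2C.
- rewrite sub2x rmorphD rmorphM rmorphXn /= /grade sub2C !sub2x sub2y.
  rewrite rmorphM /= map_polyC /= sub2x map_polyXn expr1 /= polyCD polyCM polyC_exp.
  by rewrite exprMn; ring.
- by rewrite /grade !sub2y rmorphM /= map_polyC /= sub2y map_polyXn.
Qed.

Lemma wdeg_shear q g b : wdeg q 1 (shear q g b) = wdeg q 1 b.
Proof.
rewrite /wdeg grade_shear size_map_inj_poly ?rmorph0 //.
exact: can_inj (changeK (shear_change q g)).
Qed.

Lemma lead_shear q g b : lead q 1 (shear q g b) = shear q g (lead q 1 b).
Proof.
rewrite /lead grade_shear lead_coef_map_inj ?rmorph0 //.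
exact: can_inj (changeK (shear_change q g)).
Qed.

Lemma lead_subr_lt w1 w2 a b : (wdeg w1 w2 a < wdeg w1 w2 b)%N ->
  lead w1 w2 (a - b) = - lead w1 w2 b.
Proof.
have ltn_of_pred (m n : nat) : (m.-1 < n.-1)%N -> (m < n)%N by case: n m => [|n] [].
move=> /ltn_of_pred lt; rewrite /lead (rmorphB (grade F w1 w2)).
by rewrite lead_coefDr ?lead_coefN // size_polyN.
Qed.

Lemma wdeg_subr_le w1 w2 a b k : (wdeg w1 w2 a <= k)%N -> (wdeg w1 w2 b <= k)%N ->
  (wdeg w1 w2 (a - b) <= k)%N.
Proof.
move=> ha hb; apply: wdeg_le => i j; rewrite !coefB => h.
have [a0|/(wdeg_ge w1 w2)] := eqVneq (a`_j`_i) 0; last by move/leq_trans; apply.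
apply: leq_trans hb; apply: wdeg_ge; apply: contraNneq h => b0.
by rewrite a0 b0 subr0.
Qed.

Lemma homog_x q p : homog q p q (bx : biv F).
Proof.
have -> : bx = cst 1 * bx ^+ 1 * 'X^0 :> biv F by rewrite !polyC1; ring.
by apply: homog_monom; rewrite muln1 muln0 addn0.
Qed.
Lemma homog_y q p : homog q p p ('X : biv F).
Proof.
have -> : 'X = cst 1 * bx ^+ 0 * 'X^1 :> biv F by rewrite !polyC1; ring.
by apply: homog_monom; rewrite muln1 muln0 add0n.
Qed.
Lemma bx_neq0 : bx != 0 :> biv F. Proof. by rewrite polyC_eq0 polyX_eq0. Qed.
Lemma by_neq0 : 'X != 0 :> biv F. Proof. by rewrite polyX_eq0. Qed.

Lemma lead_homog w1 w2 k e : e != 0 -> homog w1 w2 k e -> lead w1 w2 e = e.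
Proof.
move=> e0 /homogE he; rewrite /lead he lead_coefM lead_coefC lead_coefXn mulr1 //.
Qed.

Lemma fixed_prime_moved s I : fixed_prime s I ->
  exists c, (c = bx \/ c = 'X) /\ s c != c.
Proof.
case=> sc _ [b sb] _ _; apply: NNPP => h; case/eqP: sb; move: b.
have hc c : c = bx \/ c = 'X -> s c = c.
  by move=> hc; apply/eqP/negPn/negP => sc'; apply: h; exists c.
by apply: endo_id => //; apply: hc; [left|right].
Qed.

Lemma nilp_coord c b : c = bx \/ c = 'X -> nilp c b.
Proof. by case=> ->; [apply: nilp_bx | apply: nilp_by]. Qed.

(* An edge of the Newton polygon of [f] issuing from its vertex [y^d]. *)
Lemma newton_edge d f : (forall i j, f`_j`_i != 0 -> (i + j <= d)%N) ->
  (exists i j, f`_j`_i != 0 /\ (0 < i)%N) ->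
  exists q p i j, [/\ coprime p q, (0 < p)%N, (p <= q)%N,
     f`_j`_i != 0 /\ (0 < i)%N /\ (q * i + p * j = p * d)%N &
     forall i' j', f`_j'`_i' != 0 -> (q * i' + p * j' <= p * d)%N].
Proof.
move=> hd [i1 [j1 h1]].
(* The edge minimises the slope [(d - j) / i]; since [0 < i <= d], the factor [d!] makes it a
   natural number. *)
have [|[i j] [/= fij i0] hmin] := @min_measure _ (fun z : nat * nat => f`_z.2`_z.1 != 0 /\ (0 < z.1)%N)
   (fun z => (d - z.2) * (d`! %/ z.1))%N; first by exists (i1, j1).
have le_ij := hd _ _ fij.
have min' i' j' : f`_j'`_i' != 0 -> ((d - j) * i' <= (d - j') * i)%N.
  move=> h'; have [->|i'0] := posnP i'; first by rewrite muln0.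
  have le_ij' := hd _ _ h'.
  have := hmin (i', j') (conj h' i'0) => /= hm.
  have di : (i %| d`!)%N by apply: dvdn_fact; lia.
  have di' : (i' %| d`!)%N by apply: dvdn_fact; lia.
  have := leq_mul hm (leqnn (i * i')%N).
  have -> : ((d - j) * (d`! %/ i) * (i * i') = ((d - j) * i') * d`!)%N.
    by rewrite -{2}(divnK di); ring.
  have -> : ((d - j') * (d`! %/ i') * (i * i') = ((d - j') * i) * d`!)%N.
    by rewrite -{2}(divnK di'); ring.
  by rewrite leq_pmul2r // fact_gt0.
(* The slope in lowest terms [q / p] gives the weights, and [p <= q] comes from [i + j <= d]. *)
set e := gcdn i (d - j).
have e0 : (0 < e)%N by rewrite gcdn_gt0 i0.
have iE : (i = i %/ e * e)%N by rewrite divnK // dvdn_gcdl.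
have dE : (d - j = (d - j) %/ e * e)%N by rewrite divnK // dvdn_gcdr.
move: (i %/ e)%N ((d - j) %/ e)%N iE dE => p q iE dE.
have p0 : (0 < p)%N by move: i0; rewrite iE muln_gt0 => /andP[].
exists q, p, i, j; split=> //.
- rewrite /coprime -(eqn_pmul2r e0) mul1n muln_gcdl -iE -dE; exact: eqxx.
- by rewrite -(leq_pmul2r e0) -iE -dE; lia.
- split=> //; split=> //; have dj : (d = (d - j) + j)%N by lia.
  by rewrite dj {1}iE {1}dE; ring.
move=> i' j' h'; have := min' _ _ h'; rewrite dE iE.
have -> : (q * e * i' = q * i' * e)%N by ring.
rewrite mulnA leq_pmul2r // => h; have le' := hd _ _ h'.
have dj : (d = (d - j') + j')%N by lia.
by rewrite dj mulnDr leq_add2r [(p * _)%N]mulnC.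
Qed.

Lemma coef_sub1_y r i j : (sub1 (cc F) 'X r)`_j`_i = r`_j *+ (i == 0%N).
Proof.
suff -> : sub1 (cc F) 'X r = map_poly polyC r by rewrite coef_map coefC; case: (i == 0%N).
elim/poly_ind: r => [|r c IH]; first by rewrite !rmorph0.
by rewrite !rmorphD !rmorphM IH /= sub1X sub1C map_polyX map_polyC.
Qed.

Definition monom_le q p d f := forall i j, f`_j`_i != 0 -> (q * i + p * j <= d)%N.

Definition y_part f : {poly F} := map_poly (fun a : {poly F} => a`_0) f.

Lemma coef_y_part f j : (y_part f)`_j = f`_j`_0.
Proof. by rewrite coef_map_id0 // coef0. Qed.

(* With the weights of an edge at [y^d], [f] divides [c - s c] for a coordinate [c]. Either
   [s c] has small weight, and then [f] is linear in [x], or the leading form of [f] divides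
   that of [s c], which is a power of [x - g y^q]. *)
Lemma shear_step s I f d : fixed_prime s I -> f != 0 -> I f ->
  (forall b, I b -> exists e, b = f * e) ->
  monom_le 1 1 d f -> f`_d`_0 != 0 ->
  rational_param I \/
  exists q g, [/\ (0 < q)%N, exists i j, [/\ f`_j`_i != 0, (0 < i)%N & (q * i + j = d)%N] &
    forall i j, (shear q g f)`_j`_i != 0 -> (q * i + j <= d)%N /\ ((q * i + j)%N = d -> j = 0%N)].
Proof.
move=> hs f0 If gen hd fd; have pI := fixed_ideal hs.
have hd' i j : f`_j`_i != 0 -> (i + j <= d)%N by move/hd; rewrite !mul1n.
have [hi|hi] := classic (exists i j, f`_j`_i != 0 /\ (0 < i)%N); last first.
  left; have r0 : y_part f != 0.
    by apply: contraNneq fd => h; rewrite -coef_y_part h coef0.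
  apply: (param_y pI r0).
  suff -> : sub1 (cc F) 'X (y_part f) = f by [].
  apply/polyP => j; apply/polyP => i; rewrite coef_sub1_y coef_y_part.
  case: i => [|i] //=; apply/eqP; rewrite mulr0n eq_sym; apply/negPn/negP => h.
  by apply: hi; exists i.+1, j.
have [q [p [i [j [pq p0 le_pq [fij [i0 ijE]] edge]]]]] := newton_edge hd' hi.
have q0 : (0 < q)%N by apply: leq_trans le_pq.
have fdeg : wdeg q p f = (p * d)%N.
  apply/eqP; rewrite eqn_leq wdeg_le //=.
  by have := wdeg_ge q p fd; rewrite muln0.
have lead_ij : (lead q p f)`_j`_i != 0 by rewrite coef_lead fdeg ijE eqxx.
have lead_d : (lead q p f)`_d`_0 != 0 by rewrite coef_lead fdeg muln0 add0n eqxx.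
have lead0 : lead q p f != 0 by rewrite lead_eq0.
(* The leading form contains both [y^d] and [x^i y^j] with [i > 0], so it is not a monomial. *)
have [u u0 fu] : exists2 u, u != 0 & ev (lead q p f) u 1 = 0.
  case: (torus_root p0 q0 (@homog_lead F q p f) lead0) => // -[c [i' [j' [c0 E]]]].
  move: lead_ij lead_d; rewrite E !coef_monom.
  case: (eqVneq i i') => [<-|_]; last by rewrite andbF eqxx.
  by rewrite (ltn_eqF i0) andbF eqxx.
have [c [hc sc]] := fixed_prime_moved hs.
have [e hE] := gen _ (fixed_cong hs c).
have h0 : c - s c != 0 by rewrite subr_eq0 eq_sym.
have e0 : e != 0 by apply: contraNneq h0 => e0; rewrite hE e0 mulr0.
have cdeg : (wdeg q p c <= q)%N.
  case: hc => ->; first by rewrite (wdeg_homog bx_neq0 (@homog_x q p)).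
  by rewrite (wdeg_homog by_neq0 (@homog_y q p)).
(* In the first case the weight [q i + p j = p d] of [f] is at most [q], which forces [i = 1] and
   [j = 0], and [f] is the equation of a graph over the [y] axis. *)
have [le_s|lt_s] := leqP (wdeg q p (s c)) q.
  left; have := wdeg_subr_le cdeg le_s; rewrite hE wdegM // fdeg => le_d.
  have le : (q * i + p * j <= q)%N by rewrite ijE; apply: leq_trans le_d; apply: leq_addr.
  have i1 : i = 1%N.
    apply/eqP; rewrite eqn_leq i0 andbT -(leq_pmul2l q0) muln1.
    by apply: leq_trans le; apply: leq_addr.
  have j0 : j = 0%N.
    move: le; rewrite i1 muln1 -[leqRHS]addn0 leq_add2l leqn0 muln_eq0 (gtn_eqF p0).
    by move/eqP.
  have dE : (p * d)%N = q by rewrite -ijE i1 j0 muln1 muln0 addn0.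
  subst i j; rewrite dE in edge.
  apply: (@param_graph _ _ pI (f`_0`_1) (y_part f)) => //.
  suff -> : cst f`_0`_1 * bx + sub1 (cc F) 'X (y_part f) = f by [].
  apply/polyP => j; apply/polyP => i; rewrite !coefD coef_sub1_y coef_y_part.
  have -> : cst f`_0`_1 * bx = cst f`_0`_1 * bx ^+ 1 * 'X^0 :> biv F by ring.
  have edge1 : f`_j`_i != 0 -> i = 0%N \/ i = 1%N /\ j = 0%N.
    move/edge; case: i => [|[|i]]; first by left.
      2: move=> /(leq_trans (leq_addr _ _)); rewrite mulnS -[leqRHS]addn0 leq_add2l.
      2: by rewrite leqn0 muln_eq0 (gtn_eqF q0).
    rewrite muln1 -[leqRHS]addn0 leq_add2l leqn0 muln_eq0 (gtn_eqF p0) => /eqP.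
    by right.
  rewrite coef_monom; have [fij0|/edge1[->|[-> ->]]] := eqVneq (f`_j`_i) 0; last 2 first.
  - by rewrite andbF add0r.
  - by rewrite /= addr0.
  case: i edge1 fij0 => [|[|i]] _ fij0; rewrite ?andbF ?add0r //=.
  by rewrite addr0 andbT fij0; case: j fij0 => // ->.
right; set P := lead q p (s c).
have PE : lead q p f * (- lead q p e) = P.
  rewrite mulrN -leadM -hE (lead_subr_lt (leq_ltn_trans cdeg lt_s)) opprK //.
have P0 : P != 0 by rewrite lead_eq0 -(rmorph0 s) (inj_eq (inv_inj (fixed_involutive hs)));
  case: hc => ->; [exact: bx_neq0 | exact: by_neq0].
have nils b : nilp (s c) b.
  apply: (nilp_involution (fixed_cst hs) (fixed_involutive hs)) => b'.
  exact: nilp_coord.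
have nilP b : nilp P b.
  apply: nilp_gen.
    by rewrite -[bx](lead_homog bx_neq0 (@homog_x q p)); apply: nilp_lead.
  by rewrite -['X](lead_homog by_neq0 (@homog_y q p)); apply: nilp_lead.
have Pu : ev P u 1 = 0 by rewrite -PE evM fu mul0r.
have [p1 [g g0 ker]] := kernel_binom p0 q0 pq nilP (@homog_lead F q p (s c)) P0 u0 (oner_neq0 F) Pu le_pq.
subst p; have [||kf _] := @kernel_factor _ P (lead q 1 f) (- lead q 1 e) nilP.
- by rewrite PE.
- by rewrite PE bracketrr.
have [k [m [k0 leadE]]] := ker _ _ (@homog_lead F q 1 f) lead0 kf.
exists q, g; split=> //; first by exists i, j; split=> //; move: ijE; rewrite !mul1n.
have sdeg : wdeg q 1 (shear q g f) = d by rewrite wdeg_shear fdeg mul1n.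
move=> i' j' h'; split; first by have := wdeg_ge q 1 h'; rewrite sdeg mul1n.
move=> E; have : (lead q 1 (shear q g f))`_j'`_i' != 0.
  by rewrite coef_lead sdeg mul1n E eqxx.
rewrite lead_shear leadE rmorphM rmorphXn (change_cst (shear_change q g)).
(* The shear carries the binomial to [x], so in top weight only [x^m] survives. *)
have -> : shear q g (wbinom 1 q g) = bx.
  rewrite /wbinom expr1 rmorphB rmorphM rmorphXn /= /shear sub2x sub2y sub2C /=; ring.
rewrite (_ : cst k * bx ^+ m = cst k * bx ^+ m * 'X^0); last by ring.
by rewrite coef_monom; case: (eqVneq j' 0%N); rewrite // eqxx.
Qed.
End FixedCurve.

(** * Descent on the total degree *)

Section Reduction.
Variable F : numClosedFieldType.
Implicit Types a b e f : biv F.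
Implicit Type I : biv F -> Prop.

(** The bound is put on some nonzero member of [I], not on a generator, so that [c - s c] can start
    the descent. *)
Definition low_degree_param d := forall s I f, fixed_prime s I -> f != 0 -> I f ->
  (forall i j, f`_j`_i != 0 -> (i + j < d)%N) -> rational_param I.

Lemma change_param T T' s I : @coord_change F T T' -> fixed_prime s I ->
  (fixed_prime (T \o (s \o T')) (fun b => I (T' b)) -> rational_param (fun b => I (T' b))) ->
  rational_param I.
Proof.
move=> hT hs h; have hs' := fixed_prime_change hT hs.
exact: (rational_param_change hT (fixed_ideal hs') (h hs')).
Qed.

Lemma change_neq0 T T' f : @coord_change F T T' -> f != 0 -> T f != 0.
Proof. by move=> hT; apply: contra => /eqP h; rewrite -[f](changeK hT) h rmorph0. Qed.

(** The edge at [y^d] meets a monomial with [i + j < d = q i + j], so [q >= 2]. After the shear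
    [y^d] is gone and a monomial containing [x] has total degree strictly below its weight, so the
    degree drops. *)
Lemma param_of_pure_top d s I f : low_degree_param d -> fixed_prime s I -> f != 0 -> I f ->
  (forall b, I b -> exists e, b = f * e) -> monom_le 1 1 d f -> f`_d`_0 != 0 ->
  (forall i j, f`_j`_i != 0 -> (0 < i)%N -> (i + j < d)%N) -> rational_param I.
Proof.
move=> low hs f0 If gen hd fd pure.
have [//|[q [g [q0 [i [j [fij i0 ij]]] hf]]]] := shear_step hs f0 If gen hd fd.
have lt_ij := pure _ _ fij i0.
have q2 : (1 < q)%N by case: q q0 ij {hf} => [|[|q]] // _; rewrite mul1n; lia.
have hT := shear_change q g.
apply: (change_param hT hs) => hs'; apply: (low _ _ (shear q g f) hs').
- exact: (change_neq0 hT f0).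
- by rewrite (changeK hT).
move=> i' j' h'; have [le_d eq_d] := hf _ _ h'.
case: (posnP i') => [i'0|i'0]; first by subst i'; move: le_d eq_d; rewrite muln0 add0n; lia.
by apply: leq_trans le_d; rewrite ltn_add2r ltn_Pmull.
Qed.

(* A shear with [q = 1] keeps the total degree but leaves only [x^d] in the top form; after
   exchanging the variables the next shear has [q >= 2]. *)
Lemma param_of_top d s I f : low_degree_param d -> fixed_prime s I -> f != 0 -> I f ->
  (forall b, I b -> exists e, b = f * e) -> monom_le 1 1 d f -> f`_d`_0 != 0 ->
  rational_param I.
Proof.
move=> low hs f0 If gen hd fd.
have [//|[q [g [q0 [i [j [fij i0 ij]]] hf]]]] := shear_step hs f0 If gen hd fd.
have hT := shear_change q g; apply: (change_param hT hs) => hs1.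
set f1 := shear q g f in hf; have f10 : f1 != 0 := change_neq0 hT f0.
have If1 : I (shear q (- g) f1) by rewrite (changeK hT).
have gen1 := generator_change hT gen.
have d0 : (0 < d)%N by rewrite -ij addn_gt0 muln_gt0 q0 i0.
apply: (change_param (swap_change F) hs1) => hs2.
set f2 := swap F f1; have f20 : f2 != 0 := change_neq0 (swap_change F) f10.
have If2 : I (shear q (- g) (swap F f2)) by rewrite (changeK (swap_change F)).
have gen2 := generator_change (swap_change F) gen1.
(* After the exchange, [y^d] is the only monomial that can still have total degree [d]. *)
have hf2 i' j' : f2`_j'`_i' != 0 -> (i' + j' <= d)%N /\ ((i' + j')%N = d -> i' = 0%N).
  rewrite coef_swap => /hf [le eq]; case: (posnP j') => [j'0|j'0].
    by subst j'; rewrite muln0 add0n in le eq; lia.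
  have lt : (j' <= q * j')%N by rewrite leq_pmull.
  split=> [|E]; first by lia.
  by apply: eq; lia.
have [f2d|f2d] := eqVneq (f2`_d`_0) 0.
  apply: (low _ _ f2 hs2) => // i' j' h'; have [le eq] := hf2 _ _ h'.
  rewrite ltn_neqAle le andbT; apply/eqP => E; have i'0 := eq E.
  by rewrite i'0 add0n in E; move: h'; rewrite i'0 E f2d eqxx.
apply: (param_of_pure_top low hs2 f20 If2 gen2) => // [i' j'|i' j' /hf2 [le eq] i'0].
  by move=> /hf2 []; rewrite !mul1n.
by rewrite ltn_neqAle le andbT; apply/eqP => /eq i'e; rewrite i'e in i'0.
Qed.

(** Unless the curve lies in a line [x = c], its ideal is principal, and only a generator of degree
    exactly [d] needs work: a linear shear makes its coefficient of [y^d] nonzero. *)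
Lemma low_degree_paramP d : low_degree_param d.
Proof.
elim: d => [|d IH] s I f hs f0 If fd.
  by have [i [j [/fd]]] := wdeg_attained 1 1 f0.
have pI := fixed_ideal hs.
have [[c hc]|hc] := classic (exists c, I (bx - cst c)); first exact: (param_line pI hc).
have [|h [h0 Ih gen]] := ideal_principal pI _ (ex_intro2 _ _ f f0 If).
  by move=> c Ic; apply: hc; exists c.
have [e fE] := gen _ If.
have e0 : e != 0 by apply: contraNneq f0 => e0; rewrite fE e0 mulr0.
have hle : (wdeg 1 1 h <= d)%N.
  apply: (@leq_trans (wdeg 1 1 f)); first by rewrite fE wdegM // leq_addr.
  by apply: wdeg_le => i j /fd; rewrite !mul1n.
have [lt|ge] := ltnP (wdeg 1 1 h) d.
  apply: (IH s I h) => // i j /(wdeg_ge 1 1); rewrite !mul1n => le.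
  exact: (leq_ltn_trans le lt).
have hd : wdeg 1 1 h = d by apply/eqP; rewrite eqn_leq hle ge.
have lh0 : lead 1 1 h != 0 by rewrite lead_eq0.
(* The shear [x -> x + c y] moves the value of the top form at [(c, 1)] to [(0, 1)], where it is the
   coefficient of [y^d]. *)
have [c hc1] : exists c, ev (lead 1 1 h) c 1 != 0.
  have /closed_nonrootP[c] := dehomog_neq0 (ltn0Sn 0) (ltn0Sn 0) (@homog_lead F 1 1 h) lh0.
  by exists c; rewrite /ev polyC1.
have hT := shear_change 1 c; apply: (change_param hT hs) => hs1.
have deg1 : wdeg 1 1 (shear 1 c h) = d by rewrite wdeg_shear.
apply: (param_of_top (d := d) IH hs1 (f := shear 1 c h)).
- exact: (change_neq0 hT h0).
- by rewrite (changeK hT).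
- exact: (generator_change hT gen).
- by move=> i j /(wdeg_ge 1 1); rewrite deg1.
suff : (lead 1 1 (shear 1 c h))`_d`_0 != 0.
  by rewrite coef_lead deg1 muln0 mul1n add0n eqxx.
have ev_shear b : ev (shear 1 c b) 0 1 = ev b c 1.
  elim/biv_ind: b => [z|||a b ea eb|a b ea eb].
  - by rewrite (change_cst hT) !ev_const_eq0.
  - by rewrite /shear sub2x /ev !hornerE.
  - by rewrite /shear sub2y /ev !hornerE.
  - by rewrite rmorphD !evD ea eb.
  - by rewrite rmorphM !evM ea eb.
apply: contraNneq hc1 => l0; rewrite -ev_shear -lead_shear.
set l := lead 1 1 _ in l0 *.
have hl : homog 1 1 d l by rewrite -deg1; apply: homog_lead.
have : (l.[1])`_0 = 0.
  rewrite horner_coef coef_sum big1 // => j _; rewrite expr1n mulr1.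
  have [//|h'] := eqVneq (l`_j`_0) 0; have := hl _ _ h'.
  by rewrite muln0 mul1n add0n => jd; move: h'; rewrite jd l0 eqxx.
by rewrite /ev polyC1 horner_coef0 => ->.
Qed.

Theorem fixed_prime_param s I : fixed_prime s I -> rational_param I.
Proof.
move=> hs; have [c [_ sc]] := fixed_prime_moved hs.
apply: (@low_degree_paramP (wdeg 1 1 (c - s c)).+1 s I (c - s c)) => //.
- by rewrite subr_eq0 eq_sym.
- exact: (fixed_cong hs c).
by move=> i j /(wdeg_ge 1 1); rewrite !mul1n ltnS.
Qed.
End Reduction.

(** * The affine cubic has no rational parametrization *)

Section NoParametrization.
Variable F : numFieldType.
Implicit Types a b e h r : {poly F}.

Lemma deriv_eq0_size r : r^`() = 0 -> (size r <= 1)%N.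
Proof.
move=> h; apply/leq_sizeP => -[//|j] _; have /eqP := congr1 (fun p : {poly F} => p`_j) h.
by rewrite coef_deriv coef0 -mulr_natr mulf_eq0 pnatr_eq0 orbF => /eqP.
Qed.

(** The expression is the numerator of the derivative of [a / r^k]. *)
Lemma size_wronskian k a r : (size (a^`() * r - k%:R * (a * r^`()))%R <= (size a + size r).-2)%N.
Proof.
have szM (p q : {poly F}) : (size (p^`() * q)%R <= (size p + size q).-2)%N.
  have [->|p0] := eqVneq p 0; first by rewrite linear0 mul0r size_poly0.
  apply: leq_trans (size_polyMleq _ _) _; have := lt_size_deriv p0.
  move: (size p) (size q) (size p^`()) => m n l; lia.
rewrite (leq_trans (size_polyD _ _)) // geq_max size_polyN szM /=.
have -> : k%:R * (a * r^`()) = k%:R%:P * (r^`() * a) :> {poly F} by rewrite polyC_natr; ring.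
rewrite mul_polyC (leq_trans (size_scale_leq _ _)) // addnC; exact: szM.
Qed.

(* The invariant differential [dx/y] has no pole, so its numerator vanishes for degree reasons. *)
Lemma cubic_poly_const a b r : r != 0 -> coprimep a r -> a ^+ 3 + b ^+ 2 = r ^+ 6 ->
  (size r <= 1)%N /\ (size a <= 1)%N.
Proof.
move=> r0 car E.
(* With [x = a / r^2] and [y = b / r^3], [W] and [V] are the numerators of [x'] and [y'], and
   [3 x^2 x' = - 2 y y'] clears to [WV]. *)
set W := a^`() * r - 2%:R * (a * r^`()); set V := b^`() * r - 3%:R * (b * r^`()).
have WV : 3%:R * a ^+ 2 * W = - (2%:R * V) * b.
  have /(congr1 (fun p : {poly F} => p^`() * r)) := E.
  rewrite derivD !deriv_exp /= -[_ *+ 3]mulr_natl -[_ *+ 2]mulr_natl -[_ *+ 6]mulr_natl => dE.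
  have : 3%:R * a ^+ 2 * W + 2%:R * b * V = 0.
    transitivity ((3%:R * (a^`() * a ^+ 2) + 2%:R * (b^`() * b ^+ 1)) * r
      - 6%:R * r^`() * (a ^+ 3 + b ^+ 2)); first by rewrite /W /V; ring.
    by rewrite dE E; ring.
  by move/eqP; rewrite addr_eq0 => /eqP ->; ring.
have cab : coprimep a b.
  rewrite -(coprimep_pexpr a b (isT : (0 < 2)%N)).
  have -> : b ^+ 2 = - a ^+ 2 * a + r ^+ 6 by rewrite -E; ring.
  by rewrite coprimep_addl_mul coprimep_expr.
have [W0|W0] := eqVneq W 0.
  have : r %| 2%:R * (a * r^`()).
    move/eqP: W0; rewrite subr_eq0 => /eqP <-; exact: dvdp_mull.
  rewrite -[2%:R]polyC_natr mul_polyC dvdpZr ?pnatr_eq0 // Gauss_dvdpr; last by rewrite coprimep_sym.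
  have [dr0 _|dr0] := eqVneq r^`() 0; last first.
    by move/(dvdp_leq dr0); rewrite leqNgt lt_size_deriv.
  split; first exact: deriv_eq0_size.
  move: W0; rewrite /W dr0 !mulr0 subr0 => /eqP.
  by rewrite mulf_eq0 (negPf r0) orbF => /eqP /deriv_eq0_size.
have a0 : a != 0 by apply: contraNneq W0 => a0; rewrite /W a0 linear0 !(mul0r, mulr0) subr0.
have n3 : 3%:R != 0 :> {poly F} by rewrite -polyC_natr polyC_eq0 pnatr_eq0.
have n2 : 2%:R != 0 :> {poly F} by rewrite -polyC_natr polyC_eq0 pnatr_eq0.
have lhs0 : 3%:R * a ^+ 2 * W != 0 by rewrite !mulf_neq0 // expf_neq0.
have V0 : V != 0 by apply: contraNneq lhs0 => V0; rewrite WV V0 mulr0 oppr0 mul0r.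
have b0 : b != 0 by apply: contraNneq lhs0 => b0; rewrite WV b0 mulr0.
have bW : b %| W.
  have : b %| 3%:R * (a ^+ 2 * W) by rewrite mulrA WV dvdp_mull.
  rewrite -[3%:R]polyC_natr mul_polyC dvdpZr ?pnatr_eq0 // Gauss_dvdpr //.
  by rewrite coprimep_sym coprimep_expl.
have aV : a ^+ 2 %| V.
  have : a ^+ 2 %| 2%:R * (V * b).
    by rewrite -dvdpNr -mulNr mulrA mulNr -WV -mulrA dvdp_mull // dvdp_mulr.
  rewrite -[2%:R]polyC_natr mul_polyC dvdpZr ?pnatr_eq0 // Gauss_dvdpl //.
  by rewrite coprimep_expl.
have h1 := leq_trans (dvdp_leq W0 bW) (size_wronskian 2 a r).
have h2 := leq_trans (dvdp_leq V0 aV) (size_wronskian 3 b r).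
have h3 : (size (r ^+ 6) <= maxn (size (a ^+ 3)) (size (b ^+ 2)))%N by rewrite -E size_polyD.
have szX (p : {poly F}) n : p != 0 -> size (p ^+ n) = ((size p).-1 * n).+1.
  by move=> p0; rewrite -size_exp prednK // size_poly_gt0 expf_neq0.
move: h1 h2 h3; rewrite !szX // => h1 h2 h3.
move: a0 b0 r0 h1 h2 h3; rewrite -!size_poly_gt0.
move: (size a) (size b) (size r) => m n l m0 n0 l0.
(* For the degrees [A], [B], [R] of [a], [b], [r], the bounds [B <= A + R - 1] and
   [2 A <= B + R - 1] give [A <= 2 R - 2] and [B <= 3 R - 3], against [6 R <= max(3 A, 2 B)]. *)
rewrite leq_max; lia.
Qed.

(** In lowest terms [x = a / e] and [y = b / h], the equation makes [e^3] and [h^2] divide each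
    other, so [e = k r^2] and [h = k r^3]; dividing [a] and [b] by the constant [k] reduces to
    [cubic_poly_const]. *)
Lemma cubic_param_const (A A' B B' : {poly F}) : A' != 0 -> B' != 0 ->
  A ^+ 3 * B' ^+ 2 + B ^+ 2 * A' ^+ 3 = A' ^+ 3 * B' ^+ 2 -> exists k : F, A = k *: A'.
Proof.
move=> A'0 B'0 E; set g := gcdp A A'; set g' := gcdp B B'.
have AE : A = A %/ g * g by rewrite divpK // dvdp_gcdl.
have A'E : A' = A' %/ g * g by rewrite divpK // dvdp_gcdr.
have BE : B = B %/ g' * g' by rewrite divpK // dvdp_gcdl.
have B'E : B' = B' %/ g' * g' by rewrite divpK // dvdp_gcdr.
have cA : coprimep (A %/ g) (A' %/ g) by rewrite coprimep_div_gcd // A'0 orbT.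
have cB : coprimep (B %/ g') (B' %/ g') by rewrite coprimep_div_gcd // B'0 orbT.
move: (A %/ g) (A' %/ g) (B %/ g') (B' %/ g') AE A'E BE B'E cA cB => a e b h.
move=> AE A'E BE B'E cA cB.
have [e0 g0] : e != 0 /\ g != 0 by move: A'0; rewrite A'E mulf_eq0 negb_or => /andP.
have [h0 g'0] : h != 0 /\ g' != 0 by move: B'0; rewrite B'E mulf_eq0 negb_or => /andP.
have {E} E : a ^+ 3 * h ^+ 2 + b ^+ 2 * e ^+ 3 = e ^+ 3 * h ^+ 2.
  apply: (mulfI (x := g ^+ 3 * g' ^+ 2)); first by rewrite mulf_neq0 // expf_neq0.
  transitivity (A ^+ 3 * B' ^+ 2 + B ^+ 2 * A' ^+ 3); first by rewrite AE A'E BE B'E; ring.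
  by rewrite E A'E B'E; ring.
have eh : e ^+ 3 %| h ^+ 2.
  have : e ^+ 3 %| a ^+ 3 * h ^+ 2.
    have -> : a ^+ 3 * h ^+ 2 = e ^+ 3 * (h ^+ 2 - b ^+ 2) by rewrite mulrBr -E; ring.
    exact: dvdp_mulr.
  by rewrite Gauss_dvdpr // coprimep_expl // coprimep_expr // coprimep_sym.
have he : h ^+ 2 %| e ^+ 3.
  have : h ^+ 2 %| b ^+ 2 * e ^+ 3.
    have -> : b ^+ 2 * e ^+ 3 = h ^+ 2 * (e ^+ 3 - a ^+ 3) by rewrite mulrBr [h ^+ 2 * e ^+ 3]mulrC -E; ring.
    exact: dvdp_mulr.
  by rewrite Gauss_dvdpr // coprimep_expl // coprimep_expr // coprimep_sym.
have /dvdpP[r hr] : e %| h.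
  rewrite -(@dvdp_pexp2r _ e h 2) //; apply: dvdp_trans eh; rewrite [e ^+ 3]exprS; exact: dvdp_mull.
have r0 : r != 0 by apply: contraNneq h0 => r0; rewrite hr r0 mul0r.
have /eqpP[[c1 c2] /= /andP[c10 c20] cE] : h ^+ 2 %= e ^+ 3 by rewrite /eqp he eh.
have {cE} eE : e = (c1 / c2) *: r ^+ 2.
  have e20 : e ^+ 2 != 0 by rewrite expf_neq0.
  apply: (mulfI e20); rewrite -exprSr -[LHS](scalerK c20) -cE hr scalerA -scalerAr.
  by rewrite [c2^-1 * c1]mulrC exprMn [r ^+ 2 * _]mulrC.
set k := c1 / c2 in eE; have k0 : k != 0 by rewrite mulf_neq0 ?invr_eq0.
have car : coprimep (k^-1 *: a) r.
  rewrite coprimepZl ?invr_eq0 //; apply: coprimep_dvdl cA.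
  by rewrite eE dvdpZr // expr2 dvdp_mulr.
have E' : (k^-1 *: a) ^+ 3 + (k^-1 *: b) ^+ 2 = r ^+ 6.
  have m0 : (k ^+ 3)%:P * (k ^+ 2)%:P * r ^+ 6 != 0.
    by rewrite !mulf_neq0 ?expf_neq0 // polyC_eq0 expf_neq0.
  have kk : k%:P * (k^-1)%:P = 1 :> {poly F} by rewrite -polyCM mulfV.
  have aE : a = k%:P * ((k^-1)%:P * a) by rewrite mulrA kk mul1r.
  have bE : b = k%:P * ((k^-1)%:P * b) by rewrite mulrA kk mul1r.
  apply: (mulfI m0); rewrite -!mul_polyC; move: E; rewrite hr eE -mul_polyC {1}aE {1}bE.
  rewrite !polyC_exp => E.
  transitivity ((k%:P * ((k^-1)%:P * a)) ^+ 3 * (r * (k%:P * r ^+ 2)) ^+ 2 +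
     (k%:P * ((k^-1)%:P * b)) ^+ 2 * (k%:P * r ^+ 2) ^+ 3); first by ring.
  by rewrite E; ring.
have [/size1_polyC rc /size1_polyC ac] := cubic_poly_const r0 car E'.
have [z0 rz] : r`_0 != 0 /\ r = (r`_0)%:P by split=> //; rewrite -polyC_eq0 -rc.
exists ((k^-1 *: a)`_0 / r`_0 ^+ 2).
rewrite AE A'E eE scalerAl; congr (_ * _).
have aE : a = k *: (k^-1 *: a) by rewrite scalerA mulfV // scale1r.
rewrite [LHS]aE.
set x := (k^-1 *: a)`_0 in ac *; set y := r`_0 in z0 rc *.
rewrite ac rc -polyC_exp -!mul_polyC -!polyCM; congr (_%:P).
by rewrite [k * y ^+ 2]mulrC mulrA divfK ?expf_neq0 // mulrC.
Qed.
End NoParametrization.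

(** * First-order jets and the dimension of a chart *)

Section Jets.
Variable F : numClosedFieldType.
Implicit Types (f g : F -> F) (K L N : {poly F}).

Definition near0 (Q : F -> Prop) :=
  exists2 N : {poly F}, N.[0] != 0 & forall t, N.[t] != 0 -> Q t.

(** An algebraic derivative at [0] for a bare map: the remainder after the linear term is [t^2]
    times a rational function regular at [0]. *)
Definition jet f c0 c1 := exists K L, L.[0] != 0 /\
  forall t, L.[t] != 0 -> f t = c0 + c1 * t + t ^+ 2 * (K.[t] / L.[t]).

Lemma near0_and (Q R : F -> Prop) : near0 Q -> near0 R -> near0 (fun t => Q t /\ R t).
Proof.
move=> [M M0 hM] [N N0 hN]; exists (M * N); first by rewrite hornerM mulf_neq0.
by move=> t; rewrite hornerM mulf_eq0 negb_or => /andP[/hM ? /hN].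
Qed.

Lemma near0_imp (Q R : F -> Prop) : (forall t, Q t -> R t) -> near0 Q -> near0 R.
Proof. by move=> h [N N0 hN]; exists N => // t /hN /h. Qed.

Lemma near0_ex Q : near0 Q -> exists2 t, t != 0 & Q t.
Proof.
case=> N N0 hN; have n0 : N * 'X != 0.
  by rewrite mulf_neq0 ?polyX_eq0 //; apply: contraNneq N0 => ->; rewrite horner0.
have /closed_nonrootP[t] := n0.
by rewrite rootM negb_or => /andP[/hN h]; rewrite /root hornerX => t0; exists t.
Qed.

Lemma jet_at0 f c0 c1 : jet f c0 c1 -> f 0 = c0.
Proof. by case=> K [L [L0 /(_ _ L0) ->]]; rewrite expr0n mul0r mulr0 !addr0. Qed.

Lemma jet_ext f g c0 c1 : near0 (fun t => f t = g t) -> jet f c0 c1 -> jet g c0 c1.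
Proof.
move=> [N N0 hN] [K [L [L0 hf]]]; exists (K * N), (L * N).
split=> [|t]; first by rewrite hornerM mulf_neq0.
rewrite !hornerM mulf_eq0 negb_or => /andP[Lt Nt].
by rewrite -hN // hf // -mulf_div divff // mulr1.
Qed.

Lemma jet_line a b : jet (fun t => a + t * b) a b.
Proof.
exists 0, 1; rewrite hornerC oner_neq0; split=> // t _.
by rewrite horner0 mul0r mulr0 addr0 mulrC.
Qed.

Lemma jet_const a : jet (fun _ => a) a 0.
Proof.
exists 0, 1; rewrite hornerC oner_neq0; split=> // t _.
by rewrite horner0 !mul0r mulr0 !addr0.
Qed.

Lemma jetD f g a b a' b' : jet f a b -> jet g a' b' ->
  jet (fun t => f t + g t) (a + a') (b + b').
Proof.
move=> [K [L [L0 hf]]] [K' [L' [L'0 hg]]]; exists (K * L' + K' * L), (L * L').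
split=> [|t]; first by rewrite hornerM mulf_neq0.
rewrite hornerD !hornerM mulf_eq0 negb_or => /andP[Lt Lt'].
by rewrite hf // hg //; field; rewrite Lt Lt'.
Qed.

Lemma jetM f g a b a' b' : jet f a b -> jet g a' b' ->
  jet (fun t => f t * g t) (a * a') (a * b' + b * a').
Proof.
move=> [K [L [L0 hf]]] [K' [L' [L'0 hg]]].
exists ((a%:P + b%:P * 'X) * K' * L + (a'%:P + b'%:P * 'X) * K * L' + (b * b')%:P * L * L'
  + 'X ^+ 2 * K * K'), (L * L').
split=> [|t]; first by rewrite hornerM mulf_neq0.
rewrite !hornerE mulf_eq0 negb_or => /andP[Lt Lt'].
by rewrite hf // hg //=; field; rewrite Lt Lt'.
Qed.

Lemma jet_neq0 f a b : jet f a b -> a != 0 -> near0 (fun t => f t != 0).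
Proof.
move=> [K [L [L0 hf]]] a0; exists (L * (L * (a%:P + b%:P * 'X) + 'X ^+ 2 * K)).
  have -> : (L * (L * (a%:P + b%:P * 'X) + 'X ^+ 2 * K)).[0] = L.[0] * (L.[0] * a).
    by rewrite !hornerE /=; ring.
  by rewrite !mulf_neq0.
move=> t; rewrite !hornerE /= mulf_eq0 negb_or => /andP[Lt Gt]; rewrite hf //.
apply: contraNneq Gt => E; apply/eqP; transitivity (L.[t] * (a + b * t + t ^+ 2 * (K.[t] / L.[t]))).
  by field; rewrite Lt.
by rewrite E mulr0.
Qed.

Lemma jetV f a b : a != 0 -> jet f a b -> jet (fun t => (f t)^-1) a^-1 (- b / a ^+ 2).
Proof.
move=> a0 [K [L [L0 hf]]]; pose G := L * (a%:P + b%:P * 'X) + 'X ^+ 2 * K.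
have G0 : G.[0] != 0.
  have -> : G.[0] = L.[0] * a by rewrite /G !hornerE /=; ring.
  by rewrite mulf_neq0.
exists ((- a%:P * K + (b ^+ 2)%:P * L + b%:P * 'X * K) * L), ((a ^+ 2)%:P * G * L).
split=> [|t]; first by rewrite 2!hornerM hornerC !mulf_neq0 // expf_neq0.
rewrite 2!hornerM hornerC !mulf_eq0 !negb_or => /andP[/andP[_ Gt] Lt].
have fE : f t = G.[t] / L.[t] by rewrite hf // /G !hornerE /=; field; rewrite Lt.
rewrite fE; move: Gt; rewrite /G !hornerE /= => Gt; field.
by rewrite Lt a0 /= Gt.
Qed.

Lemma jet_uniq f a b a' b' : jet f a b -> jet f a' b' -> b = b'.
Proof.
move=> j j'; have aa : a = a' by rewrite -(jet_at0 j) (jet_at0 j').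
case: j j' => [K [L [L0 hf]]] [K' [L' [L'0 hf']]]; subst a'.
(* The difference of the two expansions, cleared of denominators and divided by [t]. It vanishes off
   finitely many points, hence identically, and its value at [0] is a nonzero multiple of
   [b - b']. *)
pose p := (b - b')%:P * (L * L') - 'X * (K' * L - K * L').
have p0 : p = 0.
  apply/eqP/negPn/negP => p0; have : p * ('X * (L * L')) != 0.
    rewrite !mulf_neq0 ?polyX_eq0 //; first by apply: contraNneq L0 => ->; rewrite horner0.
    by apply: contraNneq L'0 => ->; rewrite horner0.
  case/closed_nonrootP => t; rewrite /root !hornerM !mulf_eq0 !negb_or hornerX.
  case/and4P => pt t0 Lt Lt'; case/eqP: pt.
  have := hf' _ Lt'; rewrite hf // => /eqP; rewrite -subr_eq0 => /eqP E.
  rewrite /p !hornerE /=; apply: (mulfI t0); rewrite mulr0.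
  transitivity (L.[t] * L'.[t] * (a + b * t + t ^+ 2 * (K.[t] / L.[t]) -
    (a + b' * t + t ^+ 2 * (K'.[t] / L'.[t])))); last by rewrite E mulr0.
  by field; rewrite Lt Lt'.
have := congr1 (fun r : {poly F} => r.[0]) p0; rewrite /p !hornerE /= ?mul0r ?subr0 => /eqP.
by rewrite !mulf_eq0 (negPf L0) (negPf L'0) !orbF subr_eq0 => /eqP.
Qed.
End Jets.

Lemma zopen_basic n (W : Point n -> Prop) p : zopen W -> W p ->
  exists k, [/\ polyfun k, k p != 0 & forall q, k q != 0 -> W q].
Proof.
move=> [Fam [hF WE]] /WE [k [Fk kp]]; exists k; split=> //; first exact: hF.
by move=> q kq; apply/WE; exists k.
Qed.

Lemma zopen_and n (W W' : Point n -> Prop) : zopen W -> zopen W' ->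
  zopen (fun p => W p /\ W' p).
Proof.
move=> [K [hK WE]] [K' [hK' WE']].
exists (fun f => exists k k', [/\ K k, K' k' & f = fun p => k p * k' p]).
split=> [f [k [k' [Kk Kk' ->]]]|p]; first exact: (pf_mul (hK _ Kk) (hK' _ Kk')).
rewrite WE WE'; split=> [[[k [Kk kp]] [k' [Kk' kp']]]|[f [[k [k' [Kk Kk' ->]]]]]].
  by exists (fun p => k p * k' p); rewrite mulf_neq0 //; split=> //; exists k, k'.
by rewrite mulf_eq0 negb_or => /andP[kp kp']; split; [exists k | exists k'].
Qed.

(** * Gradients of regular functions *)

Section Gradient.
Variable n : nat.

(** The chain rule along curves inside [X] is taken as the definition; on a surface such a [G] is
    not unique, and any choice will do. *)
Definition has_gradient (X : Point n -> Prop) (f : Point n -> C) (p G : Point n) :=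
  forall (c : C -> Point n) (v : Point n),
    (forall i, jet (fun t => c t i) (p i) (v i)) -> near0 (fun t => X (c t)) ->
    jet (fun t => f (c t)) (f p) (\sum_i G i * v i).

Lemma polyfun_gradient f p : polyfun f -> exists G, has_gradient (fun _ => True) f p G.
Proof.
elim=> [a|i|g h _ [G hG] _ [H hH]|g h _ [G hG] _ [H hH]].
- exists (fun _ => 0) => c v _ _; rewrite big1; first exact: jet_const.
  by move=> i _; rewrite mul0r.
- exists (fun j => (j == i)%:R) => c v hv _.
  rewrite (bigD1 i) //= eqxx mul1r big1 ?addr0; first exact: hv.
  by move=> j /negPf ->; rewrite mul0r.
- exists (fun i => G i + H i) => c v hv hc.
  under eq_bigr do rewrite mulrDl.
  by rewrite big_split; apply: jetD; [apply: hG | apply: hH].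
- exists (fun i => g p * H i + G i * h p) => c v hv hc.
  have -> : \sum_i (g p * H i + G i * h p) * v i =
     g p * (\sum_i H i * v i) + (\sum_i G i * v i) * h p.
    by rewrite mulr_sumr mulr_suml -big_split; apply: eq_bigr => i _ /=; ring.
  by apply: jetM; [apply: hG | apply: hH].
Qed.

Lemma near0_zopen (W : Point n -> Prop) (c : C -> Point n) (p v : Point n) :
  zopen W -> W p -> (forall i, jet (fun t => c t i) (p i) (v i)) -> near0 (fun t => W (c t)).
Proof.
move=> hW Wp hv; have [k [hk kp kW]] := zopen_basic hW Wp.
have [G hG] := polyfun_gradient p hk.
apply: near0_imp (jet_neq0 (hG c v hv _) kp) => [t|]; first exact: kW.
by exists 1 => //; rewrite hornerC oner_neq0.
Qed.

Lemma regular_gradient (X : Point n -> Prop) f p : regular X f -> X p ->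
  exists G, has_gradient X f p G.
Proof.
move=> rf Xp; have [W [g [h [hW Wp hg hh fE]]]] := rf p Xp.
have [hp0 fp] := fE _ Xp Wp.
have [G hG] := polyfun_gradient p hg; have [H hH] := polyfun_gradient p hh.
exists (fun i => g p * (- H i / h p ^+ 2) + G i * (h p)^-1) => c v hv hc.
have triv : near0 (fun t : C => True) by exists 1 => //; rewrite hornerC oner_neq0.
have j := jetM (hG c v hv triv) (jetV hp0 (hH c v hv triv)).
rewrite fp; have -> : \sum_i (g p * (- H i / h p ^+ 2) + G i / h p) * v i =
   g p * (- (\sum_i H i * v i) / h p ^+ 2) + (\sum_i G i * v i) * (h p)^-1.
  rewrite mulr_suml -sumrN mulr_suml mulr_sumr -big_split; apply: eq_bigr => i _ /=.
  by field.
apply: jet_ext j; apply: near0_imp (near0_and hc (near0_zopen hW Wp hv)) => t [Xt Wt].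
by rewrite (fE _ Xt Wt).2.
Qed.
End Gradient.

Definition p0 : Point 3 := pt3 0 1 0.
Lemma S_p0 : S p0. Proof. by rewrite /S /p0 /pt3 /=; ring. Qed.

(* At [p0] the equation of [S] has differential [2 dy], so the Jacobian of a chart [psi],
   which has rank [n], is killed by one nonzero column vector. *)
Lemma chart_dim n (U : Point 3 -> Prop) (V : Point n -> Prop) phi :
  open_in S U -> U p0 -> zopen V -> isomorphism U V phi -> (n <= 2)%N.
Proof.
move=> [WU [hWU UE]] Up0 hV [[phiV phireg] [psi [[psiU psireg] phiK psiK]]].
set q0 := phi p0; have Vq0 : V q0 := phiV _ Up0.
have psiq0 : psi q0 = p0 by apply: phiK.
have /fin_all_exists [G hG] : forall i, exists G, has_gradient V (fun q => psi q i) q0 G.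
  by move=> i; apply: regular_gradient.
have /fin_all_exists [H hH] : forall j, exists H, has_gradient U (fun p => phi p j) p0 H.
  by move=> j; apply: regular_gradient.
pose M : 'M[C]_(n, 3) := \matrix_(k, i) G i k.
pose N : 'M[C]_(3, n) := \matrix_(i, j) H j i.
pose e (k : 'I_n) : Point n := fun i => (i == k)%:R.
pose l (k : 'I_n) (t : C) : Point n := fun i => q0 i + t * e k i.
have jl k i : jet (fun t => l k t i) (q0 i) (e k i) by apply: jet_line.
have Vl k : near0 (fun t => V (l k t)) := near0_zopen hV Vq0 (jl k).
have jpsi k i : jet (fun t => psi (l k t) i) (p0 i) (M k i).
  have := hG i _ _ (jl k) (Vl k); rewrite psiq0 mxE.
  rewrite (bigD1 k) //= {1}/e eqxx mulr1 big1 ?addr0 // => j /negPf jk.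
  by rewrite /e jk mulr0.
have Ul k : near0 (fun t => U (psi (l k t))) by apply: near0_imp (Vl k) => t /psiU.
(* Chain rule for [phi] after [psi] along the coordinate lines through [q0]. *)
have MN : M *m N = 1%:M.
  apply/matrixP => k j; rewrite !mxE.
  have j1 := hH j (fun t => psi (l k t)) _ (jpsi k) (Ul k).
  have j2 : jet (fun t => phi (psi (l k t)) j) (q0 j) (e k j).
    by apply: jet_ext (jl k j); apply: near0_imp (Vl k) => t Vt; rewrite psiK.
  rewrite eq_sym -[RHS]/(e k j) -(jet_uniq j1 j2).
  by apply: eq_bigr => i _; rewrite !mxE mulrC.
have Mcy k : M k cy = 0.
  have jx := jpsi k cx; have jy := jpsi k cy; have jz := jpsi k cz.
  have jS := jetD (jetD (jetD (jetM jz jz) (jetM jy jy)) (jetM jx (jetM jx jx))) (jet_const (-1)).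
  have := jet_uniq (jet_ext _ jS) (jet_const 0).
  rewrite /p0 /pt3 /= => /(_ _)/eqP.
  rewrite !(mul0r, mulr0, mul1r, mulr1, add0r, addr0) -mulr2n -mulr_natr mulf_eq0.
  rewrite pnatr_eq0 orbF => h; apply/eqP/h.
  apply: near0_imp (Ul k) => t /UE [St _]; move: St; rewrite /S => St.
  by rewrite -[RHS]St; ring.
have MD : M *m (delta_mx cy 0 : 'cV[C]_3) = 0.
  apply/matrixP => k j; rewrite mxE [RHS]mxE; apply: big1 => i _.
  rewrite [delta_mx _ _ _ _]mxE; case: (eqVneq i cy) => [->|_]; last by rewrite mulr0.
  by rewrite Mcy mul0r.
have := mulmx0_rank_max MD; rewrite mxrank_delta.
have : (n <= \rank M)%N by have := mxrankM_maxl M N; rewrite MN mxrank1.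
lia.
Qed.

(** * The fixed curve of the surface *)

Definition curveE (p : Point 3) : Prop := S p /\ p cz = 0.

Lemma curveE_eq p : curveE p -> p cy ^+ 2 = 1 - p cx ^+ 3.
Proof.
by rewrite /curveE /S => -[Sp z0]; apply/eqP; rewrite -subr_eq0 -Sp z0; apply/eqP; ring.
Qed.

Lemma curveE_lift x : exists p, curveE p /\ p cx = x.
Proof.
exists (pt3 x (sqrtC (1 - x ^+ 3)) 0); split=> //; split=> //.
by rewrite /S /pt3 /= sqrtCK; ring.
Qed.

Lemma curveE_fixed p : curveE p -> tauS p = p.
Proof. by case=> _ z0; rewrite tauS_pt3 -[RHS]pt3_eta z0 oppr0. Qed.

Lemma curveE_p0 : curveE p0. Proof. by split; [exact: S_p0|]. Qed.

Lemma polyfun_curveE k : polyfun k -> exists a b : {poly C},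
  forall p : Point 3, curveE p -> k p = a.[p cx] + b.[p cx] * p cy.
Proof.
elim=> [c|i|f g _ [a [b hf]] _ [a' [b' hg]]|f g _ [a [b hf]] _ [a' [b' hg]]].
- by exists c%:P, 0 => p _; rewrite hornerC horner0 mul0r addr0.
- case: (ord3P i) => ->.
  + by exists 'X, 0 => p _; rewrite hornerX horner0 mul0r addr0.
  + by exists 0, 1 => p _; rewrite horner0 hornerC mul1r add0r.
  + by exists 0, 0 => p [_ ->]; rewrite horner0 mul0r add0r.
- exists (a + a'), (b + b') => p Ep; rewrite hf // hg // !hornerD; ring.
exists (a * a' + b * b' * (1 - 'X ^+ 3)), (a * b' + b * a') => p Ep; rewrite hf // hg //.
rewrite !hornerD !hornerM !hornerD hornerN hornerC horner_exp hornerX -(curveE_eq Ep); ring.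
Qed.

(* Nonempty open subsets of the curve are cofinite: the norm [a^2 - b^2 (1 - x^3)] of
   [a + b y] is nonzero because its two terms have degrees of different parity. *)
Lemma curveE_open (W : Point 3 -> Prop) p1 : zopen W -> W p1 -> curveE p1 ->
  exists2 N : {poly C}, N != 0 & forall p, curveE p -> N.[p cx] != 0 -> W p.
Proof.
move=> hW Wp1 Ep1; have [k [hk kp1 kW]] := zopen_basic hW Wp1.
have [a [b kE]] := polyfun_curveE hk.
pose r : {poly C} := 1 - 'X ^+ 3.
have sr : size r = 4.
  rewrite /r -size_polyN opprB -[1]/(1%:P) size_XnsubC //.
have r0 : r != 0 by rewrite -size_poly_gt0 sr.
exists (a ^+ 2 - b ^+ 2 * r).
  apply: contraNneq kp1 => /eqP; rewrite subr_eq0 => /eqP E.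
  have sX (p : {poly C}) : p != 0 -> size (p ^+ 2) = ((size p).-1 * 2).+1.
    by move=> p_0; rewrite -size_exp prednK // size_poly_gt0 expf_neq0.
  have b0 : b = 0.
    apply/eqP/negPn/negP => b0; have b20 : b ^+ 2 != 0 by rewrite expf_neq0.
    have a0 : a != 0.
      by move: (mulf_neq0 b20 r0); rewrite -E; apply: contraNneq => ->; rewrite expr0n.
    have : size (a ^+ 2) = size (b ^+ 2 * r) by rewrite E.
    rewrite (size_mul b20 r0) sr !sX //; lia.
  have a0 : a = 0.
    by move/eqP: E; rewrite b0 expr0n mul0r expf_eq0 => /andP[_ /eqP].
  by rewrite kE // a0 b0 !horner0 mul0r addr0.
move=> p Ep Np; apply: NNPP => nW; case/eqP: Np; have k0 : k p = 0.
  by apply/eqP/negPn/negP => /kW.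
transitivity (k p * (a.[p cx] - b.[p cx] * p cy)); last by rewrite k0 mul0r.
have rx : r.[p cx] = 1 - p cx ^+ 3 by rewrite /r hornerD hornerN hornerC hornerXn.
rewrite kE // hornerD hornerN [(b ^+ 2 * r).[_]]hornerM !horner_exp rx.
by rewrite -(curveE_eq Ep); ring.
Qed.

Lemma regular_polyfun_comp m n (X : Point m -> Prop) (phi : Point m -> Point n) k :
  polyfun k -> (forall i, regular X (fun p => phi p i)) -> regular X (fun p => k (phi p)).
Proof.
move=> hk hphi; elim: hk => [c|i|f g _ hf _ hg|f g _ hf _ hg].
- exact: (regular_polyfun (X := X) (pf_const m c)).
- exact: hphi.
- move=> p Xp; have [W [a [b [hW Wp pa pb E]]]] := hf p Xp.
  have [W' [a' [b' [hW' Wp' pa' pb' E']]]] := hg p Xp.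
  exists (fun q => W q /\ W' q), (fun q => a q * b' q + a' q * b q), (fun q => b q * b' q).
  split; [exact: zopen_and | by [] | by polyfun_tac | by polyfun_tac |].
  move=> q Xq [Wq Wq']; have [bq ->] := E _ Xq Wq; have [bq' ->] := E' _ Xq Wq'.
  by split; [rewrite mulf_neq0 | field; rewrite bq bq'].
- move=> p Xp; have [W [a [b [hW Wp pa pb E]]]] := hf p Xp.
  have [W' [a' [b' [hW' Wp' pa' pb' E']]]] := hg p Xp.
  exists (fun q => W q /\ W' q), (fun q => a q * a' q), (fun q => b q * b' q).
  split; [exact: zopen_and | by [] | by polyfun_tac | by polyfun_tac |].
  move=> q Xq [Wq Wq']; have [bq ->] := E _ Xq Wq; have [bq' ->] := E' _ Xq Wq'.
  by split; [rewrite mulf_neq0 | field; rewrite bq bq'].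
Qed.

Lemma regular_preimage m n (X : Point m -> Prop) (phi : Point m -> Point n) W p :
  (forall i, regular X (fun p => phi p i)) -> X p -> zopen W -> W (phi p) ->
  exists O, [/\ zopen O, O p & forall q, X q -> O q -> W (phi q)].
Proof.
move=> hphi Xp hW Wp; have [k [hk kp kW]] := zopen_basic hW Wp.
have [O [g [h [hO Op hg hh E]]]] := regular_polyfun_comp hk hphi Xp.
have [hp kE] := E _ Xp Op.
exists (fun q => O q /\ g q != 0); split.
- exact: zopen_and hO (zopen_nonzero hg).
- by split=> //; move: kp; rewrite kE; apply: contraNneq => ->; rewrite mul0r.
move=> q Xq [Oq gq]; apply: kW; have [hq ->] := E _ Xq Oq.
by rewrite mulf_neq0 ?invr_eq0.
Qed.

Lemma polyfun_horner n (k : Point n -> C) (c : 'I_n -> {poly C}) : polyfun k ->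
  exists r : {poly C}, forall t, k (fun i => (c i).[t]) = r.[t].
Proof.
elim=> [a|i|f g _ [a hf] _ [b hg]|f g _ [a hf] _ [b hg]].
- by exists a%:P => t; rewrite hornerC.
- by exists (c i).
- by exists (a + b) => t; rewrite hornerD hf hg.
- by exists (a * b) => t; rewrite hornerM hf hg.
Qed.

Lemma polyfun_biv (k : Point 2 -> C) : polyfun k ->
  exists b : biv C, forall q, k q = ev b (q ord0) (q ord_max).
Proof.
elim=> [a|i|f g _ [a hf] _ [b hg]|f g _ [a hf] _ [b hg]].
- by exists (cst a) => q; rewrite ev_const_eq0.
- case: (ord2P i) => ->; first by exists bx => q; rewrite /ev hornerC hornerX.
  by exists 'X => q; rewrite /ev hornerX hornerC.
- by exists (a + b) => q; rewrite evD hf hg.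
- by exists (a * b) => q; rewrite evM hf hg.
Qed.

Lemma biv_polyfun (b : biv C) : polyfun (fun q : Point 2 => ev b (q ord0) (q ord_max)).
Proof.
elim/biv_ind: b => [c|||a b ha hb|a b ha hb].
- rewrite (_ : (fun q => _) = fun=> c); first exact: pf_const.
  by apply: functional_extensionality => q; rewrite ev_const_eq0.
- rewrite (_ : (fun q => _) = fun q : Point 2 => q ord0); first exact: pf_var.
  by apply: functional_extensionality => q; rewrite /ev hornerC hornerX.
- rewrite (_ : (fun q => _) = fun q : Point 2 => q ord_max); first exact: pf_var.
  by apply: functional_extensionality => q; rewrite /ev hornerX hornerC.
- rewrite (_ : (fun q => _) = fun q : Point 2 =>
    ev a (q ord0) (q ord_max) + ev b (q ord0) (q ord_max)); first exact: pf_add.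
  by apply: functional_extensionality => q; rewrite evD.
- rewrite (_ : (fun q => _) = fun q : Point 2 =>
    ev a (q ord0) (q ord_max) * ev b (q ord0) (q ord_max)); first exact: pf_mul.
  by apply: functional_extensionality => q; rewrite evM.
Qed.

Lemma ev_on_line (F : numClosedFieldType) (b : biv F) u v : ev b u v = (on_line u b).[v].
Proof.
elim/biv_ind: b => [c|||a b ea eb|a b ea eb].
- by rewrite ev_const_eq0 /on_line /= map_polyC /= hornerC /horner_eval hornerC.
- by rewrite /ev hornerC hornerX /on_line /= map_polyC /= hornerC /horner_eval hornerX.
- by rewrite /ev hornerX hornerC /on_line /= map_polyX hornerX.
- by rewrite evD ea eb rmorphD hornerD.
- by rewrite evM ea eb rmorphM hornerM.
Qed.

Lemma ev_eq0 (F : numClosedFieldType) (b : biv F) : (forall u v, ev b u v = 0) -> b = 0.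
Proof.
have poly0 (r : {poly F}) : (forall x, r.[x] = 0) -> r = 0.
  move=> h; apply/eqP/negPn/negP => /closed_nonrootP[x].
  by rewrite /root h eqxx.
move=> h; apply/polyP => j; rewrite coef0; apply: (poly0) => u.
have -> : (b`_j).[u] = (on_line u b)`_j by rewrite coef_map.
suff -> : on_line u b = 0 by rewrite coef0.
by apply: poly0 => v; rewrite -ev_on_line.
Qed.

Lemma ev_sub2 (F : numClosedFieldType) (P Q b : biv F) u v :
  ev (sub2 (cc F) P Q b) u v = ev b (ev P u v) (ev Q u v).
Proof.
elim/biv_ind: b => [c|||a b ea eb|a b ea eb].
- by rewrite sub2C !ev_const_eq0.
- by rewrite sub2x [in RHS]/ev hornerC hornerX.
- by rewrite sub2y [in RHS]/ev hornerX hornerC.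
- by rewrite rmorphD !evD ea eb.
- by rewrite rmorphM !evM ea eb.
Qed.

Lemma ev_sub1 (F : numClosedFieldType) (g : biv F) (r : {poly F}) u v :
  ev (sub1 (cc F) g r) u v = r.[ev g u v].
Proof.
elim/poly_ind: r => [|r c IH]; first by rewrite rmorph0 horner0 /ev !horner0.
by rewrite rmorphD rmorphM evD evM IH sub1X sub1C ev_const_eq0 hornerD hornerM hornerX hornerC.
Qed.

(* The point is taken on the conic [x = 0], [y^2 + z^2 = 1]. *)
Lemma moved_point W : zopen W -> W p0 -> exists p, [/\ S p, W p & p cz != 0].
Proof.
move=> hW Wp0.
have jq : jet (fun t : C => (1 + t * 0 : C) + (0 + t * 1) * (0 + t * 1)) (1 + 0 * 0) (0 + (0 * 1 + 1 * 0)).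
  by apply: jetD; [apply: jet_line | apply: jetM; apply: jet_line].
have q0 : (1 + 0 * 0 : C) != 0 by rewrite mul0r addr0 oner_neq0.
have jy := jetM (jetD (jet_line (1 : C) 0) (jetM (jet_line (0 : C) (-1)) (jet_line (0 : C) 1))) (jetV q0 jq).
have jz := jetM (jet_line (0 : C) 2) (jetV q0 jq).
(* The parametrization [y = (1 - t^2) / (1 + t^2)], [z = 2 t / (1 + t^2)], left unsimplified so that
   it matches [jy] and [jz]. *)
pose c (t : C) : Point 3 := pt3 0
  ((1 + t * 0 + (0 + t * -1) * (0 + t * 1)) / (1 + t * 0 + (0 + t * 1) * (0 + t * 1)))
  ((0 + t * 2) / (1 + t * 0 + (0 + t * 1) * (0 + t * 1))).
have /fin_all_exists [v hv] : forall i, exists vi, jet (fun t => c t i) (p0 i) vi.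
  move=> i; case: (ord3P i) => ->.
  - by exists 0; apply: jet_const.
  - eexists; have -> : p0 cy = (1 + 0 * 0) * (1 + 0 * 0)^-1 by rewrite divff.
    exact: jy.
  - eexists; have -> : p0 cz = 0 * (1 + 0 * 0)^-1 by rewrite mul0r.
    exact: jz.
have [t t0 [Wt qt]] := near0_ex (near0_and (near0_zopen hW Wp0 hv) (jet_neq0 jq q0)).
exists (c t); split=> //; last first.
  by rewrite /c /pt3 /= !mulf_neq0 ?invr_eq0 // add0r mulf_neq0 // pnatr_eq0.
rewrite /S /c /pt3 /=; field.
by move: qt; rewrite mulr0 addr0 add0r mulr1.
Qed.

Lemma curveE_generic (N : {poly C}) : N != 0 -> exists p, curveE p /\ N.[p cx] != 0.
Proof.
case/closed_nonrootP => x Nx; have [p [Ep px]] := curveE_lift x.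
by exists p; split=> //; rewrite px.
Qed.

(** * The image of the fixed curve in a chart *)

Definition fixed_vanishing (U : Point 3 -> Prop) (phi : Point 3 -> Point 2) (b : biv C) :=
  forall p, curveE p -> U p -> ev b (phi p ord0) (phi p ord_max) = 0.

(** Primality is irreducibility: nonempty open sets of the curve omit only finitely many values of
    [x], so any two of them meet inside [U]. *)
Lemma fixed_vanishing_prime U phi : open_in S U -> U p0 ->
  (forall i, regular U (fun p => phi p i)) -> prime_ideal (fixed_vanishing U phi).
Proof.
move=> [WU [hWU UE]] Up0 hphi; have Wp0 := ((UE p0).1 Up0).2.
have [N N0 NU] := curveE_open hWU Wp0 curveE_p0.
split=> [a b ha hb p Ep Up|a b hb p Ep Up|a b hab|h1].
- by rewrite evD ha // hb // addr0.
- by rewrite evM hb // mulr0.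
- have open_nonzero c : ~ fixed_vanishing U phi c -> exists2 M : {poly C}, M != 0 &
      forall p, curveE p -> M.[p cx] != 0 -> U p -> ev c (phi p ord0) (phi p ord_max) != 0.
    move=> hc; have [p1 [Ep1 [Up1 cp1]]] : exists p, curveE p /\ U p /\
        ev c (phi p ord0) (phi p ord_max) != 0.
      apply: NNPP => h; apply: hc => p Ep Up; apply/eqP/negPn/negP => cp.
      by apply: h; exists p.
    have [O [hO Op1 OW]] :=
      regular_preimage hphi Up1 (zopen_nonzero (biv_polyfun c)) cp1.
    have [M M0 MO] := curveE_open hO Op1 Ep1.
    by exists M => // p Ep Mp Up; apply: OW => //; apply: MO.
  have [?|na] := classic (fixed_vanishing U phi a); first by left.
  have [?|nb] := classic (fixed_vanishing U phi b); first by right.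
  have [[Ma Ma0 ha] [Mb Mb0 hb]] := (open_nonzero _ na, open_nonzero _ nb).
  have [p [Ep]] := curveE_generic (mulf_neq0 (mulf_neq0 Ma0 Mb0) N0).
  rewrite !hornerM !mulf_eq0 !negb_or => /andP[/andP[Map Mbp] Np].
  have Up : U p by apply/UE; split; [case: Ep | apply: NU].
  have /eqP := hab p Ep Up; rewrite evM mulf_eq0.
  by rewrite (negPf (ha _ Ep Map Up)) (negPf (hb _ Ep Mbp Up)).
by have /eqP := h1 _ curveE_p0 Up0; rewrite -!polyC1 ev_const_eq0 oner_eq0.
Qed.

(** [s] induces an involution of the polynomial ring that is trivial on the image of the fixed
    curve, and [fixed_prime_param] supplies the parameter. *)
Lemma plane_param (U : Point 3 -> Prop) (V : Point 2 -> Prop) s phi :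
  open_in S U -> U p0 -> stable tauS U -> mu2_action_An s -> isomorphism U V phi ->
  (forall p, U p -> phi (tauS p) = s (phi p)) ->
  exists (c : 'I_2 -> {poly C}) (t : Point 2 -> C),
    forall p, curveE p -> U p -> forall i, phi p i = (c i).[t (phi p)].
Proof.
move=> openU Up0 stU [spoly sK] [[phiV phireg] [psi [_ phiK _]]] equiv.
have [P PE] := polyfun_biv (spoly ord0); have [Q QE] := polyfun_biv (spoly ord_max).
pose sg : {rmorphism biv C -> biv C} := sub2 (cc C) P Q.
have ev_sg b q : ev (sg b) (q ord0) (q ord_max) = ev b (s q ord0) (s q ord_max).
  by rewrite ev_sub2 -PE -QE.
have hs : fixed_prime sg (fixed_vanishing U phi).
  split.
  - by move=> c; rewrite /sg sub2C.
  - move=> b; apply/eqP; rewrite -subr_eq0; apply/eqP; apply: ev_eq0 => u v.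
    rewrite evD evN -[u]/(pt2 u v ord0) -[v]/(pt2 u v ord_max) !ev_sg sK.
    exact: subrr.
  (* Nontriviality: [tauS] moves some point of [U], so [s] moves its image. *)
  - have [WU [hWU UE]] := openU; have [p [Sp Wp pz]] := moved_point hWU ((UE p0).1 Up0).2.
    have Up : U p by apply/UE.
    apply: NNPP => h; have sgid b : sg b = b.
      by apply/eqP/negPn/negP => hb; apply: h; exists b.
    have sid : s (phi p) = phi p.
      rewrite -[LHS]pt2_eta -[RHS]pt2_eta; congr pt2.
        by have := ev_sg bx (phi p); rewrite sgid /ev !hornerC !hornerX.
      by have := ev_sg 'X (phi p); rewrite sgid /ev !hornerX !hornerC.
    have : tauS p = p by rewrite -(phiK _ (stU _ Up)) equiv // sid phiK.
    rewrite tauS_pt3 => /(congr1 (fun q : Point 3 => q cz)); rewrite /pt3 /= => /eqP.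
    by rewrite eq_sym -addr_eq0 -mulr2n -mulr_natr mulf_eq0 pnatr_eq0 orbF (negPf pz).
  - exact: fixed_vanishing_prime.
  - by move=> b p Ep Up; rewrite evD evN ev_sg -equiv // curveE_fixed // subrr.
have [g [u [v [hu hv]]]] := fixed_prime_param hs.
exists (fun i => if i == ord0 then u else v), (fun q => ev g (q ord0) (q ord_max)) => p Ep Up i.
have hx := hu p Ep Up; have hy := hv p Ep Up.
case: (ord2P i) => -> /=; apply/eqP; rewrite -subr_eq0 -ev_sub1.
  by move/eqP: hx; rewrite evD evN [ev bx _ _]/ev hornerC hornerX.
by move/eqP: hy; rewrite evD evN [ev 'X _ _]/ev hornerX hornerC.
Qed.

Lemma not_rational_p0 : ~ mu2_rational_at S tauS p0.
Proof.
case=> U [n [s [V [phi [openU [Up0 [stU [hs [openV [stV [iso equiv]]]]]]]]]]].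
have dim := chart_dim openU Up0 openV iso.
have [c [t ct]] : exists (c : 'I_n -> {poly C}) (t : Point n -> C),
    forall p, curveE p -> U p -> forall i, phi p i = (c i).[t (phi p)].
  case: n dim s V phi hs openV stV iso equiv => [|[|[|//]]] _ s V phi hs openV stV iso equiv.
  - by exists (fun _ => 0), (fun _ => 0) => p _ _ [].
  - exists (fun _ => 'X), (fun q => q ord0) => p _ _ i.
    by rewrite hornerX (ord1 i).
  - exact: plane_param iso equiv.
have [[phiV phireg] [psi [[psiU psireg] phiK _]]] := iso.
(* Substituting the parametrization into the local quotients for [psi] makes each coordinate of a
   generic point of the curve a quotient of polynomials in [t]. *)
have coord i : exists A A' : {poly C}, exists2 M : {poly C}, M != 0 &
    forall p, curveE p -> U p -> M.[p cx] != 0 ->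
    A'.[t (phi p)] != 0 /\ p i = A.[t (phi p)] / A'.[t (phi p)].
  have [W [g [h [hW Wq hg hh E]]]] := psireg i _ (phiV _ Up0).
  have [A AE] := polyfun_horner c hg; have [A' A'E] := polyfun_horner c hh.
  have [O [hO Op OW]] := regular_preimage phireg Up0 hW Wq.
  have [M M0 MO] := curveE_open hO Op curveE_p0.
  exists A, A', M => // p Ep Up Mp; rewrite -AE -A'E.
  have <- : phi p = fun i => (c i).[t (phi p)].
    by apply: functional_extensionality => j; apply: ct.
  have [h0 eqn] := E _ (phiV _ Up) (OW _ Up (MO _ Ep Mp)).
  by split=> //; rewrite -eqn phiK.
have [A [A' [M M0 hA]]] := coord cx; have [B [B' [M' M'0 hB]]] := coord cy.
have [WU [hWU UE]] := openU.
have [N N0 NU] := curveE_open hWU ((UE p0).1 Up0).2 curveE_p0.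
have generic (R : {poly C}) : R != 0 -> exists p, [/\ curveE p, R.[p cx] != 0,
    A'.[t (phi p)] != 0 /\ p cx = A.[t (phi p)] / A'.[t (phi p)] &
    B'.[t (phi p)] != 0 /\ p cy = B.[t (phi p)] / B'.[t (phi p)]].
  move=> R0; have [p [Ep]] := curveE_generic (mulf_neq0 (mulf_neq0 (mulf_neq0 M0 M'0) N0) R0).
  rewrite !hornerM !mulf_eq0 !negb_or => /andP[/andP[/andP[Mp M'p] Np] Rp].
  have Up : U p by apply/UE; split; [case: Ep | apply: NU].
  by exists p; split=> //; [apply: hA | apply: hB].
pose D := A ^+ 3 * B' ^+ 2 + B ^+ 2 * A' ^+ 3 - A' ^+ 3 * B' ^+ 2.
(* If [D] were nonzero, [t] would be one of its roots at every generic point, whereas some generic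
   point has [x] outside the finitely many resulting values [A / A']. *)
have D0 : D = 0.
  apply/eqP/negPn/negP => D0; have [r Dr] := closed_field_poly_normal D.
  have R0 : \prod_(z <- r) ('X - (A.[z] / A'.[z])%:P) != 0 :> {poly C}.
    by rewrite prodf_seq_neq0; apply/allP => z _; rewrite /= polyXsubC_eq0.
  have [p [Ep Rp [A'p xE] [B'p yE]]] := generic _ R0.
  have : root D (t (phi p)).
    rewrite /root /D; apply/eqP; have := curveE_eq Ep; rewrite xE yE.
    move: A'p B'p; rewrite !hornerE /=.
    move: (A.[_]) (A'.[_]) (B.[_]) (B'.[_]) => x e y h e0 h0 E.
    have {}E : y ^+ 2 = h ^+ 2 * (1 - (x / e) ^+ 3) by rewrite -E; field.
    by rewrite E; field.
  rewrite Dr rootZ ?lead_coef_eq0 // root_prod_XsubC => tr; case/eqP: Rp.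
  by rewrite (big_rem _ tr) /= hornerM hornerXsubC -xE subrr mul0r.
have [p1 [_ _ [A'p1 _] [B'p1 _]]] := generic 1 (oner_neq0 _).
have nz (R : {poly C}) z : R.[z] != 0 -> R != 0 by apply: contraNneq => ->; rewrite horner0.
have [k Ak] : exists k : C, A = k *: A'.
  apply: (@cubic_param_const _ A A' B B' (nz _ _ A'p1) (nz _ _ B'p1)).
  by move/eqP: D0; rewrite /D subr_eq0 => /eqP.
(* Now [x = k] at every generic point, but one of them can be taken with [x] different from [k]. *)
have [|p [_ Rp [A'p xE] _]] := generic ('X - k%:P); first by rewrite polyXsubC_eq0.
by move: Rp; rewrite hornerXsubC xE Ak hornerZ mulfK // subrr eqxx.
Qed.

Theorem theorem5p2 :
  weakly_mu2_uniformly_rational S tauS /\ ~ mu2_uniformly_rational S tauS.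
Proof.
split; first exact: weakly_rational_S.
by move=> /(_ p0 S_p0); apply: not_rational_p0.
Qed.
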